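(* Let $K_N$ be the finite principal matrix obtained from $\mathscr H_{(a)}$ by retaining all coordinate states of heights $0,\dots,N$; it has order $d(N+1)$. There are an integer $r_N\in\{0,\dots,M-1\}$ and a polynomial $\mathcal P_N$, with $\mathcal P_N(0)\ne0$, such that \[ \det(\lambda I-K_N)=\lambda^{r_N}\mathcal P_N(\lambda^M),\qquad r_N=d(N+1)-M\left\lfloor\frac{d(N+1)}M\right\rfloor . \] Moreover, \[ \deg\mathcal P_N=\left\lfloor\frac{d(N+1)}M\right\rfloor=\left\lfloor\frac{N+1}{P+Q}\right\rfloor . \] Every zero of $\mathcal P_N$ is positive. Hence every nonzero pole of the finite resolvent $(\lambda I-K_N)^{-1}$ lies on one of the $M=p+q$ rays from the origin through the $M$-th roots of unity. More precisely, order the retained states by factor copy and, for $c\in\{1,\dots,M\}$, let $C_{c,N}$ be the diagonal block of $K_N^M$ on the $c$-th copy. If that copy contains $n_{c,N}$ retained states and $m_N=\lfloor d(N+1)/M\rfloor$, then \[ \det(yI-C_{c,N})=y^{\,n_{c,N}-m_N}\,\mathcal P_N(y). \] Thus $\mathcal P_N$ is the characteristic polynomial of every diagonal block of order $m_N$ in the $M$-th power, and its zeros are the nonzero radial spectral parameters.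
   Context: Let $p,q\ge1$, $M=p+q$, $d=\gcd(p,q)$, $P=p/d$, $Q=q/d$, $R=P+Q$. Matrices are semi-infinite. A lower bidiagonal $L$ is normalized if $L_{n,n}=1$, an upper bidiagonal $U$ is normalized if $U_{n,n+1}=1$; positive means that the remaining entries ($L_{n+1,n}$, resp. $U_{n,n}$) are all $>0$. Let $T=L_1\cdots L_pU_q\cdots U_1$ with all factors normalized positive; $F_a=L_a$ ($1\le a\le p$), $F_{p+b}=U_{q-b+1}$ ($1\le b\le q$). Fix $a\in\mathcal A_{\mathrm{cyc}}=\{a_-,\dots,a_+\}$, $a_-=p-\lceil P/Q\rceil+1$, $a_+=p+1+\min\{q-1,\lceil Q/P\rceil\}$. Let $r_k$ be the remainder of $kQ$ mod $R$ and $\sigma_{\mathrm{min}}$ the word of length $M$ whose $(k+1)$-st letter is $L$ if $r_k<P$ and $U$ otherwise. Finitely many replacements of a neighbouring pair $U,L$ (upper before lower) by the unique normalized positive pair $\widetilde L,\widetilde U$ with $UL=\widetilde L\widetilde U$ transform $(F_a,\dots,F_M,F_1,\dots,F_{a-1})$ into a list $(\widetilde F^{(a)}_1,\dots,\widetilde F^{(a)}_M)$ of normalized positive bidiagonal factors with type word $\sigma_{\mathrm{min}}$ (independent of the choices). Matrix $\mathscr H_{(a)}$: put $\widetilde\omega_j=r_{j-1}$. Rows and columns (''coordinate states'') are indexed by pairs $(h,j)$, $h\in\mathbb N_0$ (the height), $j\in\{1,\dots,M\}$ (the factor copy), $h-\widetilde\omega_j\in R\mathbb N_0$, ordered by $h$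 and then by $j$; $n=(h-\widetilde\omega_j)/R$; $j^+=j+1$ for $j<M$, $M^+=1$. Nonzero entries: $1$ at row $(h,j)$, column $(h+Q,j^+)$; at row $(h,j)$, column $(h-P,j^+)$, the entry $(\widetilde F^{(a)}_j)_{n,n-1}$ if $\widetilde F_j^{(a)}$ is lower and $n\ge1$, and $(\widetilde F^{(a)}_j)_{n,n}$ if $\widetilde F^{(a)}_j$ is upper. Every height carries exactly $d$ states. Since each nonzero entry advances the copy label by one modulo $M$, $K_N^M$ is block diagonal with respect to factor copies. *)

(* Defs.v *)
From Stdlib Require Import Relation_Operators.
From mathcomp Require Import all_boot all_order all_algebra.
From mathcomp Require Import complex.
From mathcomp Require Import reals.

Set Implicit Arguments.
Unset Strict Implicit.
Unset Printing Implicit Defensive.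

Import Order.TTheory GRing.Theory Num.Theory.
Local Open Scope ring_scope.

Definition smx (R : Type) := nat -> nat -> R.

Section SemiInfinite.
Variable R : realType.
Implicit Types A B : smx R.

(* The row i of the left factor is supported in columns 0, ..., i + 1 in all
   products considered (lower or upper bidiagonal left factor), so this finite
   sum is the full matrix product. *)
Definition smx_mul A B : smx R :=
  fun i k => \sum_(j < i.+2) A i j * B j k.

Definition lower_bidiagonal A : Prop :=
  forall i j : nat, i != j -> i != j.+1 -> A i j = 0.

Definition upper_bidiagonal A : Prop :=
  forall i j : nat, i != j -> j != i.+1 -> A i j = 0.

Definition pos_lower A : Prop :=
  [/\ lower_bidiagonal A, forall n, A n n = 1 & forall n, 0 < A n.+1 n].

Definition pos_upper A : Prop :=
  [/\ upper_bidiagonal A, forall n, A n n.+1 = 1 & forall n, 0 < A n n].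

Inductive swapUL : seq (smx R) -> seq (smx R) -> Prop :=
| SwapUL (s1 s2 : seq (smx R)) (U L L' U' : smx R) :
    pos_upper U -> pos_lower L -> pos_lower L' -> pos_upper U' ->
    smx_mul U L =2 smx_mul L' U' ->
    swapUL (s1 ++ U :: L :: s2) (s1 ++ L' :: U' :: s2).

Definition swaps : seq (smx R) -> seq (smx R) -> Prop :=
  clos_refl_trans (seq (smx R)) swapUL.

(* In a type word, [true] is the letter L and [false] the letter U. *)
Definition has_type_word (s : seq (smx R)) (w : seq bool) : Prop :=
  size s = size w /\
  forall k, (k < size w)%N ->
    if nth false w k then pos_lower (nth (fun _ _ => 0) s k)
    else pos_upper (nth (fun _ _ => 0) s k).

(* F_1, ..., F_M = L_1, ..., L_p, U_q, ..., U_1 *)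
Definition factors (p q : nat) (L U : nat -> smx R) : seq (smx R) :=
  [seq L i | i <- iota 1 p] ++ [seq U i | i <- rev (iota 1 q)].

End SemiInfinite.

Section Arithmetic.
Variables p q : nat.

Definition redP : nat := (p %/ gcdn p q)%N.
Definition redQ : nat := (q %/ gcdn p q)%N.
Definition redR : nat := (redP + redQ)%N.

Definition ceil_div (m n : nat) : nat := ((m + n.-1) %/ n)%N.

Definition a_minus : nat := (p - ceil_div redP redQ + 1)%N.
Definition a_plus : nat := (p + 1 + minn (q - 1) (ceil_div redQ redP))%N.

Definition rmd (k : nat) : nat := ((k * redQ) %% redR)%N.

Definition sigma_min : seq bool := mkseq (fun k => (rmd k < redP)%N) (p + q)%N.

(* A coordinate state is a pair (h, j), the copy label j running over
   1, ..., p + q. *)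
Definition omega (j : nat) : nat := rmd j.-1.

Definition next_copy (j : nat) : nat := if (j < p + q)%N then j.+1 else 1%N.

Definition is_state (s : nat * nat) : bool :=
  [&& (1 <= s.2 <= p + q)%N, (omega s.2 <= s.1)%N
    & (redR %| s.1 - omega s.2)%N].

Definition state_index (s : nat * nat) : nat :=
  ((s.1 - omega s.2) %/ redR)%N.

Definition states (N : nat) : seq (nat * nat) :=
  [seq s <- [seq (h, j) | h <- iota 0 N.+1, j <- iota 1 (p + q)%N]
     | is_state s].

Definition state N (i : 'I_(size (states N))) : nat * nat :=
  nth (0%N, 0%N) (states N) i.

End Arithmetic.

Section HMatrix.
Variables (R : realType) (p q : nat) (Ft : seq (smx R)).

(* Ft is a list of factors with type word [sigma_min p q], so its j-th factor
   is lower exactly when the j-th letter of that word is L. *)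
Definition Hmx (s t : nat * nat) : R :=
  let F := nth (fun _ _ => 0) Ft s.2.-1 in
  let n := state_index p q s in
  if t.2 != next_copy p q s.2 then 0
  else if t.1 == (s.1 + redQ p q)%N then 1
  else if (t.1 + redP p q)%N == s.1 then
    if nth false (sigma_min p q) s.2.-1
    then if (1 <= n)%N then F n n.-1 else 0
    else F n n
  else 0.

Definition Kmx (N : nat) : 'M[R]_(size (states p q N)) :=
  \matrix_(i, j) Hmx (state i) (state j).

Definition copy_set (N c : nat) : {set 'I_(size (states p q N))} :=
  [set i | (state i).2 == c].

Definition Cmx (N c : nat) : 'M[R]_#|copy_set N c| :=
  mxsub (@enum_val _ (mem (copy_set N c))) (@enum_val _ (mem (copy_set N c)))
    (Kmx N ^+ (p + q)).

End HMatrix.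

Section Resolvent.
Variable F : fieldType.

(* [char_poly_mx A] is the polynomial matrix 'X%:M - A. *)
Definition resolvent n (A : 'M[F]_n) : 'M[{fraction {poly F}}]_n :=
  invmx (map_mx (@tofrac {poly F}) (char_poly_mx A)).

Definition pole (f : {fraction {poly F}}) (z : F) : Prop :=
  ~ exists u v : {poly F}, v.[z] != 0 /\ f = tofrac u / tofrac v.

Definition mx_pole n (A : 'M[{fraction {poly F}}]_n) (z : F) : Prop :=
  exists i j, pole (A i j) z.

End Resolvent.

(* Main.v *)
Require Import Defs.
From mathcomp Require Import all_boot all_order all_fingroup all_algebra.
From mathcomp Require Import zify ring.
From mathcomp Require Import complex reals.
From mathcomp Require Import boolp classical_sets topology normedtype derive.

Set Implicit Arguments.
Unset Strict Implicit.
Unset Printing Implicit Defensive.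

Import Order.TTheory GRing.Theory Num.Theory.
Import numFieldNormedType.Exports.
Local Open Scope ring_scope.

(** The matrix K_N raises the copy label by one modulo M, so it consists of M
    rectangular blocks, and the block from copy j to copy j + 1 is the leading
    corner, of size n_j by n_(j+1), of the j-th bidiagonal factor.  Writing
    m = floor ((N + 1) / R), every n_j is m or m + 1, and some n_j equals m,
    because the offsets r_j take every value below R.  Three ideas give the
    theorem.

    1. Cyclic structure ([char_poly_cyclic]).  For a matrix K of order D graded
    by the integers modulo M, let C_c be the diagonal block of K ^+ M on class
    c, of order n_c.  Then X^(M n_c) char K(X) = X^D char C_c(X^M).  The proof
    is one block elimination: the columns of
    X^M - K^M = (X - K) (X^(M-1) + X^(M-2) K + ... + K^(M-1)) in class c vanish
    outside the rows of class c.  A copy with n_c = m thus determines char K,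
    and char K determines char C_c for every other copy.

    2. Positive spectrum ([chain_char_poly]).  A product of positive bidiagonal
    corners whose sizes stay in {m, m + 1}, with first and last size m, and
    which contains a lower and an upper factor, has exactly m nonzero
    eigenvalues, counted with multiplicity, and all are positive; this goes by
    induction on m.  Such a product A is nonnegative and has a strictly positive
    power, so Perron's theorem gives A x = l x with l > 0 and x > 0.
    Follow x through the factors, x_j = F_j x_(j+1), and divide out: the factors
    become row stochastic.  A row stochastic bidiagonal matrix acts on the
    consecutive differences of a vector as a positive bidiagonal matrix of the
    same kind with both sizes lowered by one ([stochastic_deflation]).  The
    deflated product is again a chain, one size smaller, and the eigenvalue
    removed is exactly l ([char_poly_deflation]).

    3. Perron's theorem itself ([perron_on_support]) is obtained by maximizing l
    over the compact set of pairs (x, l) with x in the simplex and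
    l x <= A x.

    To avoid rectangular blocks of varying size, all matrices of a chain are
    padded with zeros to one common order.  The zeros of the common polynomial
    being positive, every nonzero eigenvalue z of K_N has z ^+ M > 0, which puts
    it on one of the M rays. *)

(** * Determinants and cyclically graded matrices *)

(** A permutation other than the identity cannot strictly raise the rank of
    every point that it moves, since the ranks have the same sum before and
    after; so only the identity survives in the Leibniz formula. *)
Lemma det_triangular_rank (R : comNzRingType) n (A : 'M[R]_n)
    (rk : 'I_n -> nat) :
  (forall i j, i != j -> (rk j <= rk i)%N -> A i j = 0) ->
  \det A = \prod_i A i i.
Proof.
move=> A0; rewrite /determinant (bigD1 1%g) //= odd_perm1 expr0 mul1r.
rewrite [X in _ + X]big1 ?addr0; last first.
  move=> s s1.
  have [i si rki] : exists2 i, i != s i & (rk (s i) <= rk i)%N.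
    apply/exists_inP; apply: contraT; rewrite negb_exists_in => /forall_inP h.
    have lerk i : (rk i <= rk (s i))%N.
      have [<-//|nsi] := eqVneq i (s i).
      by have := h i nsi; rewrite -ltnNge; apply: ltnW.
    have [i nsi] : exists i, i != s i.
      apply/existsP; apply: contraNT s1 => /existsPn sK.
      apply/eqP/permP => i; rewrite perm1; apply/eqP.
      by rewrite eq_sym -[_ == _]negbK.
    have : (\sum_i rk i < \sum_i rk (s i))%N.
      rewrite (bigD1 i) //= [X in (_ < X)%N](bigD1 i) //= -addSn.
      rewrite leq_add ?leq_sum //.
      by have := h i nsi; rewrite -ltnNge.
    by rewrite [X in (_ < X)%N](reindex_inj (@perm_inj _ s^-1%g)) /=;
       under [X in (_ < X)%N]eq_bigr do rewrite permKV; rewrite ltnn.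
  by rewrite (bigD1 i) //= A0 // mul0r mulr0.
by apply: eq_bigr => i _; rewrite perm1.
Qed.

(** The block triangular determinant for blocks that are scattered in the index
    set: [f] and [g] enumerate two complementary parts. *)
Lemma det_mxsub_block (R : comNzRingType) n k l (A : 'M[R]_n)
    (f : 'I_k -> 'I_n) (g : 'I_l -> 'I_n) :
  injective f -> injective g -> (forall i j, f i != g j) -> (k + l)%N = n ->
  (forall i j, A (g j) (f i) = 0) ->
  \det A = \det (mxsub f f A) * \det (mxsub g g A).
Proof.
move=> fI gI fg kl; move: A f g fI gI fg; rewrite -{}kl => A f g fI gI fg A0.
pose h i := match split i with inl a => f a | inr b => g b end.
have hI : injective h.
  move=> i j; rewrite /h -{2}(splitK i) -{2}(splitK j).
  case: (split i) => u; case: (split j) => v /=.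
  - by move=> /fI ->.
  - by move=> /eqP; rewrite (negPf (fg _ _)).
  - by move=> /esym/eqP; rewrite (negPf (fg _ _)).
  - by move=> /gI ->.
have <- : \det (mxsub h h A) = \det A.
  have -> : mxsub h h A = row_perm (perm hI) (col_perm (perm hI) A).
    by apply/matrixP => i j; rewrite !mxE !permE.
  rewrite row_permE col_permE !det_mulmx !det_perm odd_permV.
  rewrite [\det A * _]mulrC mulrA.
  by rewrite -expr2 sqrr_sign mul1r.
rewrite -(det_ublock _ (mxsub f g A)); congr (\det _).
apply/matrixP => i j; rewrite mxE /h -{2}(splitK i) -{2}(splitK j).
case: (split i) => u; case: (split j) => v /=.
- by rewrite block_mxEul mxE.
- by rewrite block_mxEur mxE.
- by rewrite block_mxEdl mxE.
- by rewrite block_mxEdr mxE.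
Qed.

Lemma char_poly_mxsub_support (R : comNzRingType) n k (A : 'M[R]_n)
    (g : 'I_k -> 'I_n) : injective g ->
  (forall i j, j \notin codom g -> A i j = 0) ->
  char_poly A = 'X^(n - k) * char_poly (mxsub g g A).
Proof.
move=> gI A0; pose S := ~: [set g i | i in 'I_k].
pose f := @enum_val _ (mem S).
have cS : (#|S| + k)%N = n.
  by rewrite addnC -[k in LHS]card_ord -(card_imset _ gI) cardsC card_ord.
have fS i : f i \notin codom g.
  have : f i \in S := enum_valP i; rewrite inE; apply: contra => /codomP[j ->].
  by rewrite imset_f.
rewrite /char_poly.
rewrite [LHS](@det_mxsub_block _ _ _ _ _ f g) //; first last.
- move=> i j; rewrite !mxE A0 ?fS // eq_sym.
  have [E|_] := eqVneq (f i) (g j); last by rewrite mulr0n sub0r oppr0.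
  by have := fS i; rewrite E codom_f.
- by move=> i j; apply: contra (fS i) => /eqP ->; rewrite codom_f.
- exact: enum_val_inj.
congr (_ * _).
  have -> : mxsub f f (char_poly_mx A) = 'X%:M.
    apply/matrixP => i j; rewrite !mxE A0 ?fS // subr0.
    by rewrite /f (inj_eq enum_val_inj).
  by rewrite det_scalar; congr (_ ^+ _); rewrite -[LHS](addnK k) cS.
by congr (\det _); apply/matrixP => i j; rewrite !mxE (inj_eq gI).
Qed.

Lemma graded_expmx (R : comNzRingType) n M (K : 'M[R]_n) (g : 'I_n -> nat) :
  (forall i j, K i j != 0 -> g j = (g i).+1 %[mod M]) ->
  forall t i j, (K ^+ t) i j != 0 -> g j = g i + t %[mod M].
Proof.
move=> gK; elim=> [|t IH] i j.
  by rewrite expr0 mxE addn0; have [->//|_] := eqVneq i j; rewrite eqxx.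
rewrite exprSr mxE => nz.
have [l /andP[]] : exists l, ((K ^+ t) i l != 0) && (K l j != 0).
  apply/existsP; apply: contraNT nz => /existsPn h; apply/eqP/big1 => l _.
  have := h l; rewrite negb_and !negbK => /orP[]/eqP->.
    by rewrite mul0r.
  by rewrite mulr0.
by move=> /IH e1 /gK ->; rewrite -addn1 -modnDml e1 modnDml addn1 addnS.
Qed.

(** If every entry of [K] raises the grade by one modulo [M], then
    [K ^+ M] preserves the classes; away from the class [S] the matrix [K] is
    nilpotent, because a path avoiding [S] cannot go round the cycle. *)
Lemma char_poly_cyclic (R : idomainType) n M (K : 'M[R]_n) (g : 'I_n -> nat)
    (S : {set 'I_n}) (c : nat) :
  (0 < M)%N ->
  (forall i j, K i j != 0 -> g j = (g i).+1 %[mod M]) ->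
  (forall i, (i \in S) = (g i == c %[mod M])) ->
  'X^(M * #|S|) * char_poly K =
  'X^n * (char_poly (mxsub (@enum_val _ (mem S)) (@enum_val _ (mem S)) (K ^+ M))
     \Po 'X^M).
Proof.
move=> M0 gK SP; set C := mxsub _ _ _.
have gKt := graded_expmx gK.
pose KX : 'M[{poly R}]_n := map_mx polyC K.
pose G : 'M[{poly R}]_n := \sum_(t < M) 'X%:M ^+ (M.-1 - t) * KX ^+ t.
have KXE t : KX ^+ t = map_mx polyC (K ^+ t) by rewrite rmorphXn.
have XE t : 'X%:M ^+ t = 'X^t%:M :> 'M[{poly R}]_n by rewrite rmorphXn.
have GE i j : G i j = \sum_(t < M) 'X^(M.-1 - t) * ((K ^+ t) i j)%:P.
  rewrite /G summxE; apply: eq_bigr => t _.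
  by rewrite XE KXE -mulmxE mul_scalar_mx !mxE.
have GN : char_poly_mx K *m G = 'X^M%:M - map_mx polyC (K ^+ M).
  rewrite -KXE -XE mulmxE /G /char_poly_mx -/KX subrXX_comm //.
  by rewrite /GRing.comm -mulmxE scalar_mxC.
(* Multiplying by W performs the elimination: it puts the columns of
   X^M - K^M in the class S, and leaves the other columns of X - K alone. *)
pose W : 'M[{poly R}]_n :=
  \matrix_(i, j) if j \in S then G i j else (i == j)%:R.
have GS i j : i \in S -> j \in S -> G i j = (i == j)%:R * 'X^(M.-1).
  move=> iS jS; rewrite GE (bigD1 (Ordinal M0)) //= subn0 expr0 mxE.
  rewrite big1 ?addr0 => [|t t0]; first by rewrite polyC_natr mulrC.
  have [->|/gKt] := eqVneq ((K ^+ t) i j) 0; first by rewrite polyC0 mulr0.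
  move: iS jS; rewrite !SP => /eqP e /eqP e' h.
  have : (g i + 0 == g i + t %[mod M])%N by rewrite addn0 -h e e'.
  rewrite eqn_modDl mod0n modn_small ?ltn_ord // => /eqP t1.
  by case/eqP: t0; apply: val_inj.
have detW : \det W = 'X^(M.-1 * #|S|).
  rewrite (@det_triangular_rank _ _ _ (fun i => i \in S : nat)).
    rewrite (bigID [in S]) /= mulrC big1 => [|i /negPf iS].
      rewrite mul1r (eq_bigr (fun=> 'X^(M.-1))) ?prodr_const -?exprM // => i iS.
      by rewrite mxE iS GS // eqxx mul1r.
    by rewrite mxE iS eqxx.
  move=> i j ij; rewrite mxE; case: ifP => [jS|_]; last by rewrite (negPf ij).
  by case iS: (i \in S) => // _; rewrite GS // (negPf ij) mul0r.
pose f := @enum_val _ (mem S); pose f' := @enum_val _ (mem (~: S)).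
have fS i : f i \in S := enum_valP i.
have fS' i : f' i \in S = false.
  by have := enum_valP i; rewrite inE => /negPf.
have WS i j : j \in S ->
    (char_poly_mx K *m W) i j = ('X^M%:M - map_mx polyC (K ^+ M)) i j.
  move=> jS; rewrite -GN !mxE; apply: eq_bigr => l _.
  by rewrite [W _ _]mxE jS.
have WN i j : j \notin S -> (char_poly_mx K *m W) i j = char_poly_mx K i j.
  move=> /negPf jS; rewrite mxE (bigD1 j) //= [W _ _]mxE jS eqxx mulr1.
  rewrite big1 ?addr0 // => l lj; rewrite [W _ _]mxE jS (negPf lj) mulr0 //.
have detKW : \det (char_poly_mx K *m W) =
    (char_poly C \Po 'X^M) * 'X^(n - #|S|).
  rewrite (@det_mxsub_block _ _ _ _ _ f f'); first last.
  - move=> i j; rewrite WS // !mxE.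
    have [E|_] := eqVneq (f' j) (f i); first by have := fS' j; rewrite E fS.
    have [->|/gKt] := eqVneq ((K ^+ M) (f' j) (f i)) 0.
      by rewrite mulr0n subr0.
    rewrite modnDr => e; have := fS i; rewrite SP e -SP fS' //.
  - by rewrite cardsC card_ord.
  - move=> i j; apply: contraFneq (fS' j) => <- //.
  - exact: enum_val_inj.
  - exact: enum_val_inj.
  congr (_ * _).
    rewrite /char_poly -det_map_mx; congr (\det _).
    apply/matrixP => i j; rewrite mxE WS // !mxE rmorphB rmorphMn /=.
    by rewrite comp_polyX comp_polyC (inj_eq enum_val_inj).
  (* Off the chosen class, the cyclic distance from it orders the indices. *)
  pose rk (i : 'I_n) := ((g i + (M - (c %% M))) %% M)%N.
  have rkK i j : K i j != 0 -> j \notin S -> (rk i < rk j)%N.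
    move=> /gK gij jS.
    have rkj : rk j = ((rk i).+1 %% M)%N.
      by rewrite /rk -addn1 modnDml -modnDml gij modnDml addnAC addn1.
    have : (rk i < M)%N by rewrite ltn_mod.
    rewrite leq_eqVlt => /orP[/eqP rki|]; last first.
      by move=> /modn_small; rewrite rkj => ->.
    move: rkj; rewrite rki modnn => rkj; case/negP: jS.
    have cM := ltn_pmod c M0.
    rewrite SP -(eqn_modDr (M - c %% M)) -/(rk j) rkj -modnDml.
    by rewrite subnKC 1?ltnW // modnn.
  have -> : (n - #|S|)%N = #|~: S|.
    by rewrite [RHS]cardsCs finset.setCK card_ord.
  rewrite (@det_triangular_rank _ _ _ (fun i => rk (f' i))).
    rewrite (eq_bigr (fun=> 'X)) ?prodr_const ?card_ord // => i _.
    rewrite mxE WN ?fS' // !mxE eqxx.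
    have [->|/rkK -/(_ (negbT (fS' i)))] := eqVneq (K (f' i) (f' i)) 0.
      by rewrite subr0.
    by rewrite ltnn.
  move=> i j ij; rewrite mxE WN ?fS' // !mxE (inj_eq enum_val_inj) (negPf ij).
  have [->|/rkK -/(_ (negbT (fS' j)))] := eqVneq (K (f' i) (f' j)) 0.
    by rewrite subr0.
  by rewrite ltnNge => /negPf ->.
have M1 : (M * #|S| = M.-1 * #|S| + #|S|)%N by rewrite -mulSnr prednK.
have Sn : (#|S| <= n)%N by rewrite -[X in (_ <= X)%N]card_ord max_card.
rewrite M1 exprD -mulrA [X in _ * X]mulrC mulrA [_ * char_poly K]mulrC.
rewrite -detW /char_poly -det_mulmx detKW -mulrA -exprD subnK //.
exact: mulrC.
Qed.

(** * Perron vectors by compactness *)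

Lemma closed_le_continuous (R : realType) (T : topologicalType) (f g : T -> R) :
  continuous f -> continuous g -> closed [set x | f x <= g x]%classic.
Proof.
move=> cf cg.
have -> : [set x | f x <= g x]%classic =
    ((g \- f) @^-1` [set y | 0 <= y])%classic.
  by apply/seteqP; split=> x /=; rewrite subr_ge0.
apply: preimage_closed; last exact: closed_ge.
by move=> x _; apply: continuousB; [exact: cg | exact: cf].
Qed.

Lemma mulmx_cV_gt0 (R : realType) n (A : 'M[R]_n) (S : pred 'I_n)
    (x : 'cV[R]_n) :
  (forall i j, S i -> S j -> 0 < A i j) ->
  (forall j, 0 <= x j 0) -> (forall j, ~~ S j -> x j 0 = 0) -> x != 0 ->
  forall i, S i -> 0 < (A *m x) i 0.
Proof.
move=> Apos x0 xS xn0 i Si.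
have [j xj] : exists j, x j 0 != 0.
  apply/existsP; apply: contraNT xn0 => /existsPn h; apply/eqP/colP => j.
  by apply/eqP; rewrite mxE -[_ == _]negbK.
have Sj : S j by apply: contraNT xj => /xS ->.
rewrite mxE (bigD1 j) //=; apply: ltr_wpDr.
  apply: sumr_ge0 => l _; have [Sl|/xS->] := boolP (S l); last by rewrite mulr0.
  by apply: mulr_ge0 => //; apply/ltW/Apos.
by rewrite mulr_gt0 ?Apos // lt_def xj x0.
Qed.

(** The pairs of a level [l] and a point [x] of the simplex, constrained by
    [l x <= A x], form a compact set: [l] is at most the sum of the entries of
    [A].  They are stored as the row vectors (l, x), so that one coordinate is
    to be maximized.  The bound [A i0 i0 <= l] comes from the [i0]-th unit
    vector, and later keeps the maximum positive. *)
Lemma maximal_subinvariant (R : realType) n (A : 'M[R]_n) (i0 : 'I_n) :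
  (forall i j, 0 <= A i j) ->
  exists (x : 'cV[R]_n) (l : R),
    [/\ A i0 i0 <= l, forall i, 0 <= x i 0, \sum_i x i 0 = 1
      & forall i, l * x i 0 <= (A *m x) i 0] /\
    forall (y : 'cV[R]_n) k, (forall i, 0 <= y i 0) -> y != 0 ->
      (forall i, k * y i 0 <= (A *m y) i 0) -> k <= l.
Proof.
move=> A0; pose B := \sum_i \sum_j A i j.
pose l (v : 'rV[R]_(1 + n)) : R := v ord0 ord0.
pose x (v : 'rV[R]_(1 + n)) : 'cV[R]_n := (rsubmx v)^T.
have lc : continuous l by exact: coord_continuous.
have xE v i : x v i 0 = v ord0 (rshift 1 i) by rewrite !mxE.
have xc i : continuous (fun v => x v i 0).
  have -> : (fun v => x v i 0) =
      (fun v : 'rV[R]_(1 + n) => v ord0 (rshift 1 i)).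
    by apply/funext => v; rewrite xE.
  exact: coord_continuous.
have sumc (F : 'I_n -> 'rV[R]_(1 + n) -> R) : (forall i, continuous (F i)) ->
    continuous (fun v => \sum_i F i v).
  move=> Fc; elim: (index_enum _) => [|i s IH].
    have -> : (fun v => \sum_(i <- [::]) F i v) = (fun=> 0).
      by apply/funext => v; rewrite big_nil.
    by move=> v; exact: cst_continuous.
  have -> : (fun v => \sum_(i <- i :: s) F i v) =
            F i \+ (fun v => \sum_(i <- s) F i v).
    by apply/funext => v; rewrite big_cons.
  by move=> v; apply: continuousD; [exact: Fc | exact: IH].
pose E := [set v : 'rV[R]_(1 + n) | [/\ 0 <= l v, forall i, 0 <= x v i 0,
  \sum_i x v i 0 = 1 & forall i, l v * x v i 0 <= (A *m x v) i 0]]%classic.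
have lB v : E v -> l v <= B.
  case=> l0 x0 x1 Ax; rewrite -[l v]mulr1 -x1 mulr_sumr.
  apply: ler_sum => i _; apply: le_trans (Ax i) _; rewrite mxE.
  apply: ler_sum => j _; rewrite -[leRHS]mulr1 ler_wpM2l // -x1.
  by rewrite (bigD1 j) //= lerDl sumr_ge0.
have Ec : compact E.
  apply: (@subclosed_compact _ E
    [set v : 'rV[R]_(1 + n) |
      forall i, `[0, Num.max 1 B]%classic (v ord0 i)]%classic).
  - have -> : E = ([set v | 0 <= l v] `&`
      (\bigcap_i [set v | 0 <= x v i 0]) `&`
      ([set v | \sum_i x v i 0 <= 1] `&` [set v | 1 <= \sum_i x v i 0]) `&`
      (\bigcap_i [set v | l v * x v i 0 <= (A *m x v) i 0]))%classic.
      apply/seteqP; split=> v.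
        case=> l0 x0 x1 Ax; split=> [|i _]; last exact: Ax.
        by split; [split=> [|i _] | split; rewrite /= x1]; rewrite //=.
      case=> -[[l0 x0] [/= x1 x1']] Ax; split => //.
      - by move=> i; exact: x0.
      - by apply/eqP; rewrite eq_le x1 x1'.
      - by move=> i; exact: Ax.
    apply: closedI; [apply: closedI; [apply: closedI|apply: closedI]|].
    + by apply: closed_le_continuous => //; move=> v; exact: cst_continuous.
    + by apply: closed_bigI => i _; apply: closed_le_continuous => //;
        move=> v; exact: cst_continuous.
    + apply: closed_le_continuous; first exact: sumc.
      by move=> v; exact: cst_continuous.
    + apply: closed_le_continuous; last exact: sumc.
      by move=> v; exact: cst_continuous.
    + apply: closed_bigI => i _; apply: closed_le_continuous.
        by move=> v; apply: continuousM; [exact: lc|exact: xc].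
      have -> : (fun v => (A *m x v) i 0) = (fun v => \sum_j A i j * x v j 0).
        by apply/funext => v; rewrite mxE.
      apply: sumc => j v; apply: continuousM; last exact: xc.
      exact: cst_continuous.
  - apply: (@rV_compact _ _ (fun=> `[0, Num.max 1 B]%classic)) => _.
    exact: segment_compact.
  - move=> v Ev i; case: (Ev) => l0 x0 x1 Ax; rewrite /= in_itv /=.
    rewrite -(splitK i); case: (split i) => j /=.
      have -> : lshift n j = ord0 by rewrite (ord1 j); exact: val_inj.
      by rewrite -/(l v) l0 le_max lB ?orbT.
    by rewrite -xE x0 le_max -x1 (bigD1 j) //= lerDl sumr_ge0.
have rowE k (y : 'cV[R]_n) : (forall i, 0 <= y i 0) -> y != 0 -> 0 <= k ->
    (forall i, k * y i 0 <= (A *m y) i 0) -> exists2 v, E v & l v = k.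
  move=> y0 yn0 k0 Ay; pose s := \sum_i y i 0.
  have s0 : 0 < s.
    rewrite lt_def sumr_ge0 // andbT psumr_neq0 //; apply: contraNT yn0.
    rewrite -all_predC => /allP h; apply/eqP/colP => i; rewrite mxE.
    by have := h i (mem_index_enum i); rewrite /= lt_def y0 andbT negbK => /eqP.
  have lE : l (row_mx k%:M (s^-1 *: y)^T) = k.
    transitivity (row_mx (k%:M : 'M_1) (s^-1 *: y)^T 0 (lshift n 0)).
      by congr (row_mx _ _ _ _); exact: val_inj.
    by rewrite row_mxEl mxE eqxx mulr1n.
  exists (row_mx k%:M (s^-1 *: y)^T) => //.
  rewrite /E /= lE /x row_mxKr trmxK.
  have is0 : 0 <= s^-1 by rewrite invr_ge0 ltW.
  split=> //.
  - by move=> i; rewrite mxE mulr_ge0.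
  - under eq_bigr do rewrite mxE.
    by rewrite -mulr_sumr mulVf // gt_eqF.
  - move=> i; rewrite -scalemxAr !mxE mulrCA ler_wpM2l //.
    by have := Ay i; rewrite mxE.
have [v0 Ev0 lv0] : exists2 v, E v & l v = A i0 i0.
  apply: (rowE _ (delta_mx i0 0)) => //.
  - by move=> i; rewrite mxE ler0n.
  - apply/eqP => /matrixP/(_ i0 0); rewrite !mxE !eqxx => /eqP.
    by rewrite oner_eq0.
  - move=> i; rewrite -colE !mxE eqxx andbT.
    by have [->|_] := eqVneq i i0; rewrite ?mulr1 ?mulr0.
have E0 : (E !=set0)%classic by exists v0.
have [c] := @EVT_max_rV R _ l E E0 Ec (continuous_subspaceT lc).
rewrite inE => Ec' cmax; case: (Ec') => l0 x0 x1 Ax.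
exists (x c), (l c); split; first by split => //; rewrite -lv0 cmax ?inE.
move=> y k y0 yn0 Ay; have [k0|/ltW k0] := leP 0 k; last exact: le_trans k0 l0.
by have [v Ev <-] := rowE _ _ y0 yn0 k0 Ay; rewrite cmax ?inE.
Qed.

(** Perron's theorem for a matrix that lives on a subset [S] of the indices and
    has a power strictly positive there.  At a maximal pair, if [A x] differed
    from [l x] then [A ^+ k] would make the slack [A x - l x] strictly positive
    on [S], and [l] could be increased for the vector [A ^+ k *m x]. *)
Lemma perron_on_support (R : realType) n (A : 'M[R]_n) (S : pred 'I_n) k i0 :
  (forall i j, 0 <= A i j) -> (forall i j, ~~ S i -> A i j = 0) ->
  (forall i j, S i -> S j -> 0 < (A ^+ k) i j) -> 0 < A i0 i0 ->
  exists (x : 'cV[R]_n) (l : R), [/\ 0 < l, forall i, S i -> 0 < x i 0,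
    forall i, ~~ S i -> x i 0 = 0 & A *m x = l *: x].
Proof.
move=> A0 AS Ak Ai0.
have [x [l [[lA x0 x1 Ax] lmax]]] := maximal_subinvariant i0 A0.
have l0 : 0 < l by exact: lt_le_trans lA.
have Si0 : S i0 by apply: contraTT Ai0 => /AS ->; rewrite ltxx.
have AyS (y : 'cV_n) i : ~~ S i -> (A *m y) i 0 = 0.
  by move=> Si; rewrite mxE big1 // => j _; rewrite AS // mul0r.
have xS i : ~~ S i -> x i 0 = 0.
  move=> Si; apply/eqP; rewrite -(mulrI_eq0 _ (mulfI (lt0r_neq0 l0))) eq_le.
  by rewrite -{1}(AyS x i Si) Ax mulr_ge0 // ltW.
have xn0 : x != 0.
  apply/eqP => xe; move: x1; rewrite xe big1 => [/eqP|i _]; last by rewrite mxE.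
  by rewrite eq_sym oner_eq0.
have comm : A *m A ^+ k = A ^+ k *m A by rewrite !mulmxE -exprS -exprSr.
have AxE : A *m x = l *: x.
  apply/eqP; rewrite -subr_eq0; apply: contraT => w0; exfalso.
  set w := _ - _ in w0.
  pose y := A ^+ k *m x.
  have yS i : S i -> 0 < y i 0 by apply: mulmx_cV_gt0.
  have dS i : S i -> 0 < (A *m y - l *: y) i 0.
    have -> : A *m y - l *: y = A ^+ k *m w.
      by rewrite /w mulmxBr -scalemxAr !mulmxA comm.
    apply: mulmx_cV_gt0 => //.
    - by move=> j; have := Ax j; rewrite !mxE subr_ge0.
    - by move=> j Sj; have := AyS x j Sj; rewrite !mxE xS // mulr0 subr0.
  have y_out i : ~~ S i -> y i 0 = 0.
    rewrite /y; case: (k) => [|k'] Si; first by rewrite expr0 mul1mx xS.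
    by rewrite exprS -mulmxE -mulmxA AyS.
  have y0 i : 0 <= y i 0.
    by have [/yS/ltW//|/y_out->] := boolP (S i).
  (* The increment t^-1 is admissible since t bounds every ratio y i / d i. *)
  pose d i := (A *m y - l *: y) i 0; pose t := \sum_(j | S j) y j 0 / d j.
  have t0 i : S i -> y i 0 / d i <= t.
    move=> Si; rewrite /t (bigD1 i) //= lerDl sumr_ge0 // => j /andP[Sj _].
    by rewrite divr_ge0 // ltW // dS.
  have tp : 0 < t by apply: lt_le_trans (t0 i0 Si0); rewrite divr_gt0 ?yS // dS.
  have : l + t^-1 <= l.
    apply: (lmax y) => // [|i].
      by apply/eqP => y_eq0; have := yS i0 Si0; rewrite y_eq0 mxE ltxx.
    have [Si|Si] := boolP (S i); last by rewrite y_out // mulr0 AyS.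
    have -> : (A *m y) i 0 = l * y i 0 + d i.
      by rewrite /d !mxE [RHS]addrC subrK.
    rewrite mulrDl lerD2l mulrC ler_pdivrMr // mulrC -ler_pdivrMr ?t0 //.
    exact: dS.
  by rewrite gerDl leNgt invr_gt0 tp.
exists x, l; split => // i Si.
have : 0 < (A ^+ k *m x) i 0 by exact: (mulmx_cV_gt0 Ak).
have -> : A ^+ k *m x = l ^+ k *: x.
  elim: (k) => [|k' IH]; first by rewrite !expr0 mul1mx scale1r.
  by rewrite exprS -mulmxE -mulmxA IH -scalemxAr AxE scalerA -exprSr.
by rewrite mxE pmulr_rgt0 // exprn_gt0.
Qed.

(** * Deflation of stochastic bidiagonal matrices *)

Lemma sg_bool_gt0 (R : realDomainType) (x : R) (c : bool) :
  Num.sg x = c%:R -> c -> 0 < x.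
Proof. by move=> + cT; rewrite cT => /eqP; rewrite sgr_cp0. Qed.

Lemma sg_bool_eq0 (R : realDomainType) (x : R) (c : bool) :
  Num.sg x = c%:R -> ~~ c -> x = 0.
Proof. by move=> + /negPf cF; rewrite cF => /eqP; rewrite sgr_eq0 => /eqP. Qed.

(** The positions of the possibly nonzero entries of the [n] by [n'] corner of a
    lower ([b = true]) or upper ([b = false]) bidiagonal matrix. *)
Definition bidiag_pattern (b : bool) (n n' i k : nat) : bool :=
  [&& (i < n)%N, (k < n')%N & (k == i) || (if b then i == k.+1 else k == i.+1)].

(** If [v = G u] with [G] row stochastic, then summation by parts gives
    [v i - v i.+1 = \sum_k H i k * (u k - u k.+1)], where [H i k] is the
    difference of the cumulative sums of rows [i] and [i.+1] up to column [k].
    For a bidiagonal [G] each of these sums is 0, an entry of [G], or 1, and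
    [H] is a positive bidiagonal matrix of the same type. *)
Lemma stochastic_deflation (R : realDomainType) (b : bool) (n n' : nat)
    (G : nat -> nat -> R) :
  (forall i j, (i < n)%N -> (j < n')%N ->
     Num.sg (G i j) = (bidiag_pattern b n n' i j)%:R) ->
  (forall i, (i < n)%N -> \sum_(0 <= j < n') G i j = 1) ->
  forall i k, (i.+1 < n)%N -> (k.+1 < n')%N ->
  Num.sg (\sum_(0 <= j < k.+1) G i j - \sum_(0 <= j < k.+1) G i.+1 j)
    = (bidiag_pattern b n.-1 n'.-1 i k)%:R.
Proof.
move=> Gpat G1 i k ni nk.
have G0 s j : (s < n)%N -> (j < n')%N ->
    ~~ bidiag_pattern b n n' s j -> G s j = 0.
  by move=> ns nj; apply: sg_bool_eq0; exact: Gpat.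
have low s c : (s < n)%N -> (c <= n')%N -> (c <= (if b then s.-1 else s))%N ->
    \sum_(0 <= j < c) G s j = 0.
  move=> ns nc cs; rewrite big_nat big1 // => j /andP[_ jc].
  apply: G0 => //; first by lia.
  by rewrite /bidiag_pattern; case: (b) cs => cs; apply/negP; lia.
have high s c : (s < n)%N -> ((if b then s else s.+1) < c)%N -> (c <= n')%N ->
    \sum_(0 <= j < c) G s j = 1.
  move=> ns cs cn; rewrite -(G1 s ns) [RHS](@big_cat_nat _ _ _ c) //=.
  rewrite [X in _ + X]big_nat [X in _ + X]big1 ?addr0 // => j /andP[cj jn].
  apply: G0 => //; rewrite /bidiag_pattern.
  by case: (b) cs => cs; apply/negP; lia.
have rows_split s : (s < n)%N ->
    \sum_(0 <= j < k.+1) G s j = 1 - \sum_(k.+1 <= j < n') G s j.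
  move=> ns; rewrite -(G1 s ns) [in RHS](@big_cat_nat _ _ _ k.+1) ?addrK //=.
  exact: ltnW.
have mid s c d : (s < n)%N -> (c < d)%N -> (d <= n')%N ->
   (forall j, (c < j < d)%N -> ~~ bidiag_pattern b n n' s j) ->
   \sum_(c <= j < d) G s j = G s c.
  move=> ns cd dn h; rewrite big_ltn // big_nat big1 ?addr0 // => j jc.
  by apply: G0 => //; [lia | exact: h].
rewrite /bidiag_pattern !ltn_predRL ni nk /=.
have i_n : (i < n)%N by lia.
have same (c d : bool) : c = d -> c%:R = d%:R :> R by move=> ->.
have zero (c : bool) : c = false -> 0 = c%:R :> R by move=> ->.
have one (c : bool) : c -> c%:R = 1 :> R by move=> ->.
case: b Gpat G0 low high mid => Gpat G0 low high mid.
- have [ik|ki|ki] := ltngtP i k.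
  + by rewrite !high ?subrr ?sgr0; try lia; apply: zero; lia.
  + rewrite [X in _ - X]low //; try lia.
    have [ki'|ki'] := eqVneq i k.+1; last first.
      by rewrite low ?subrr ?sgr0; try lia; apply: zero; lia.
    rewrite big_nat_recr //= low; try lia.
    rewrite add0r subr0 Gpat; try lia.
    by first [apply: one | apply: same]; rewrite /bidiag_pattern; lia.
  + subst k; rewrite high; try lia.
    rewrite rows_split; try lia; rewrite subKr mid; try lia.
      rewrite Gpat; try lia.
      by first [apply: one | apply: same]; rewrite /bidiag_pattern; lia.
    by move=> j; rewrite /bidiag_pattern; lia.
- have [ik|ki|ki] := ltngtP i k.
  + rewrite [X in X - _]high; try lia.
    have [ki'|ki'] := eqVneq k i.+1; last first.
      by rewrite high ?subrr ?sgr0; try lia; apply: zero; lia.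
    rewrite rows_split; try lia; rewrite subKr mid; try lia.
      rewrite Gpat; try lia.
      by first [apply: one | apply: same]; rewrite /bidiag_pattern; lia.
    by move=> j; rewrite /bidiag_pattern; lia.
  + by rewrite !low ?subrr ?sgr0; try lia; apply: zero; lia.
  + rewrite [X in _ - X]low //; try lia.
    rewrite big_nat_recr //= low; try lia.
    rewrite add0r subr0 Gpat; try lia.
    by first [apply: one | apply: same]; rewrite /bidiag_pattern; lia.
Qed.

Section Deflation.
Variables (R : realType) (B : nat).
Implicit Types (F A : 'M[R]_B.+1) (x y : 'cV[R]_B.+1).

(** Compared with a square corner, a lower factor may lose its last column, and
    an upper factor its last row.  In both shapes every row keeps an entry of
    the pattern as soon as there is a column. *)
Definition bidiag_sizes (b : bool) (n n' : nat) : bool :=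
  if b then (n' <= n <= n'.+1)%N else (n <= n' <= n.+1)%N.

(** Prescribing the sign of every entry says at once where the matrix vanishes
    and that it is positive elsewhere. *)
Definition pos_bidiag (b : bool) (n n' : nat) F : Prop :=
  forall i k, Num.sg (F i k) = (bidiag_pattern b n n' i k)%:R.

Definition pos_vec (n : nat) x : Prop :=
  forall i : 'I_B.+1, (i < n)%N -> 0 < x i 0.

(** The operator taking [y] to the differences [y i / x i - y i.+1 / x i.+1] of
    its consecutive ratios to [x]; its kernel on vectors of length [n] is the
    line of [x]. *)
Definition ratio_diff (n : nat) x : 'M[R]_B.+1 :=
  \matrix_(i, k) if (i.+1 < n)%N
                 then ((k == i :> nat)%:R - (k == i.+1 :> nat)%:R) / x k 0
                 else 0.

Lemma pos_bidiag_ge0 b n n' F : pos_bidiag b n n' F -> forall i k, 0 <= F i k.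
Proof.
move=> Fp i k; have [c|c] := boolP (bidiag_pattern b n n' i k).
  by rewrite ltW // (sg_bool_gt0 (Fp i k)).
by rewrite (sg_bool_eq0 (Fp i k) c).
Qed.

Lemma pos_bidiag_mul_cV b n n' F x : bidiag_sizes b n n' -> (0 < n')%N ->
  (n <= B.+1)%N -> (n' <= B.+1)%N ->
  pos_bidiag b n n' F -> pos_vec n' x -> pos_vec n (F *m x).
Proof.
move=> bs n'0 nB n'B Fp x0 i ni; rewrite mxE.
have [k ik] : exists k : 'I_B.+1, bidiag_pattern b n n' i k.
  have [in'|n'i] := ltnP i n'.
    by exists i; rewrite /bidiag_pattern ni in' eqxx.
  have kB : (i.-1 < B.+1)%N by have := ltn_ord i; lia.
  exists (Ordinal kB); move: bs; rewrite /bidiag_sizes /bidiag_pattern /=.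
  by case: (b); lia.
rewrite (bigD1 k) //=; apply: ltr_wpDr; last first.
  by rewrite mulr_gt0 ?(sg_bool_gt0 (Fp i k)) ?x0 //; case/and3P: ik.
apply: sumr_ge0 => l _; have [il|il] := boolP (bidiag_pattern b n n' i l).
  by rewrite mulr_ge0 ?ltW ?(sg_bool_gt0 (Fp i l)) ?x0 //; case/and3P: il.
by rewrite (sg_bool_eq0 (Fp i l) il) mul0r.
Qed.

(** Dividing by [x] on the right and by [F *m x] on the left makes [F] row
    stochastic, so [stochastic_deflation] applies; the identity says that the
    operators of consecutive ratio differences intertwine [F] and [F']. *)
Lemma pos_bidiag_deflation b n n' F x : bidiag_sizes b n n' -> (0 < n')%N ->
  (n <= B.+1)%N -> (n' <= B.+1)%N ->
  pos_bidiag b n n' F -> pos_vec n' x ->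
  exists2 F' : 'M[R]_B.+1, pos_bidiag b n.-1 n'.-1 F' &
    ratio_diff n (F *m x) *m F = F' *m ratio_diff n' x.
Proof.
move=> bs n'0 nB n'B Fp x0; set y := F *m x.
have y0 : pos_vec n y by apply: pos_bidiag_mul_cV Fp x0.
pose G (i j : nat) := F (inord i) (inord j) * x (inord j) 0 / y (inord i) 0.
have Gpat i j : (i < n)%N -> (j < n')%N ->
    Num.sg (G i j) = (bidiag_pattern b n n' i j)%:R.
  move=> ni nj; have iB := leq_trans ni nB; have jB := leq_trans nj n'B.
  rewrite /G !sgrM Fp sgrV !inordK // !gtr0_sg ?mulr1 //.
    by apply: y0; rewrite inordK.
  by apply: x0; rewrite inordK.
have G1 i : (i < n)%N -> \sum_(0 <= j < n') G i j = 1.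
  move=> ni; have iB : (i < B.+1)%N by lia.
  have yi : y (inord i) 0 != 0 by rewrite lt0r_neq0 ?y0 ?inordK.
  apply: (mulIf yi); rewrite mul1r mulr_suml [RHS]mxE.
  rewrite big_mkord (big_ord_widen B.+1 (fun j => G i j * y (inord i) 0) n'B).
  rewrite [RHS](bigID (fun k : 'I_B.+1 => (k < n')%N)) /=.
  rewrite [X in _ + X]big1 ?addr0.
    by apply: eq_bigr => j jn; rewrite /G inord_val divfK.
  move=> j jn; rewrite (sg_bool_eq0 (Fp _ j)) ?mul0r //.
  by rewrite /bidiag_pattern (negPf jn) andbF.
pose H i k := \sum_(0 <= j < k.+1) G i j - \sum_(0 <= j < k.+1) G i.+1 j.
pose F' : 'M[R]_B.+1 :=
  \matrix_(i, k) if (i.+1 < n)%N && (k.+1 < n')%N then H i k else 0.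
exists F'.
  move=> i k; rewrite mxE; case: ifP => [/andP[ni nk]|].
    by apply: (stochastic_deflation Gpat G1).
  rewrite sgr0 => h; rewrite (_ : bidiag_pattern _ _ _ _ _ = false) //.
  by rewrite /bidiag_pattern; lia.
apply/matrixP => i k; rewrite !mxE.
have [ni|ni] := ltnP i.+1 n; last first.
  rewrite big1 => [|j _]; last by rewrite mxE ltnNge ni /= mul0r.
  by rewrite big1 // => j _; rewrite mxE ltnNge ni /= mul0r.
have iB : (i.+1 < B.+1)%N by lia.
pose i1 := Ordinal iB.
have ratio_diffE m z j l : (ratio_diff m z : 'M[R]_B.+1) j l =
    if (j.+1 < m)%N then ((l == j :> nat)%:R - (l == j.+1 :> nat)%:R) / z l 0
    else 0 by rewrite mxE.
have -> : \sum_j ratio_diff n y i j * F j k = F i k / y i 0 - F i1 k / y i1 0.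
  rewrite (bigD1 i) //= (bigD1 i1) /=; last first.
    by apply/eqP => /(congr1 val) /=; lia.
  rewrite big1 ?addr0 => [|j /andP[ji ji1]].
    rewrite !ratio_diffE ni !eqxx /= (gtn_eqF (ltnSn i)) (ltn_eqF (ltnSn i)).
    by rewrite subr0 sub0r mulN1r mulNr mul1r ![_^-1 * _]mulrC.
  rewrite ratio_diffE ni (_ : (_ == _) = false); last by apply/negbTE.
  rewrite (_ : (_ == _) = false) ?subrr ?mul0r //.
  by apply: contraNF ji1 => /eqP e; apply/eqP/val_inj.
have [kn'|n'k] := ltnP k n'; last first.
  rewrite !(sg_bool_eq0 (Fp _ k)) ?mul0r ?subrr; first 1 last.
  - by rewrite /bidiag_pattern; lia.
  - by rewrite /bidiag_pattern; lia.
  rewrite big1 // => j _; rewrite ratio_diffE.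
  case: ifP => jn'; last by rewrite mulr0.
  have [/negPf-> /negPf->] : k != j :> nat /\ k != j.+1 :> nat by lia.
  by rewrite subrr mul0r mulr0.
have xk : x k 0 != 0 by rewrite lt0r_neq0 ?x0.
(* Both rows of G sum to 1: this removes the boundary term below. *)
have H_end : H i n'.-1 = 0.
  by rewrite /H prednK // !G1 ?subrr //; lia.
have -> : \sum_j F' i j * ratio_diff n' x j k =
    \sum_(j < B.+1)
      H i j * ((k == j :> nat)%:R - (k == j.+1 :> nat)%:R) / x k 0.
  apply: eq_bigr => j _; rewrite ratio_diffE mxE ni /=.
  case: ifP => jn'; first by rewrite mulrA.
  rewrite mul0r; have [kj|kj] := eqVneq (k : nat) j.
    by rewrite (_ : j = n'.-1 :> nat) ?H_end ?mul0r //; lia.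
  by rewrite (_ : (_ == _) = false) ?subr0 ?mulr0 ?mul0r //; lia.
rewrite -mulr_suml; under eq_bigr do rewrite mulrBr; rewrite sumrB.
have -> : \sum_(j < B.+1) H i j * (k == j :> nat)%:R = H i k.
  rewrite (bigD1 k) //= eqxx mulr1 big1 ?addr0 // => j jk.
  rewrite (_ : (_ == _) = false) ?mulr0 //.
  by apply: contraNF jk => /eqP e; apply/eqP/val_inj.
have GE (s l : 'I_B.+1) : G s l = F s l * x l 0 / y s 0.
  by rewrite /G !inord_val.
have GE1 (l : 'I_B.+1) : G i.+1 l = F i1 l * x l 0 / y i1 0 := GE i1 l.
have HS : H i k = G i k - G i.+1 k +
    (\sum_(0 <= j < k) G i j - \sum_(0 <= j < k) G i.+1 j).
  by rewrite /H !big_nat_recr //=; ring.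
have -> : \sum_(j < B.+1) H i j * (k == j.+1 :> nat)%:R =
    \sum_(0 <= j < k) G i j - \sum_(0 <= j < k) G i.+1 j.
  case: (posnP k) => [k0|k0].
    rewrite k0 !big_geq // subrr big1 // => j _; by rewrite mulr0.
  have kB : (k.-1 < B.+1)%N by have := ltn_ord k; lia.
  rewrite (bigD1 (Ordinal kB)) //= prednK // eqxx mulr1 big1 ?addr0 => [|j jk].
    by rewrite /H prednK.
  rewrite (_ : (_ == _) = false) ?mulr0 //; apply: contraNF jk => /eqP e.
  by apply/eqP/val_inj; rewrite /= e.
rewrite HS addrK GE GE1 mulrBl.
by rewrite -!mulrA !(mulrCA (x k 0)) mulfV // !mulr1.
Qed.

End Deflation.

(** * Spectrum of a chain of bidiagonal factors *)

Lemma char_poly_similar (F : fieldType) n (T A G : 'M[F]_n) :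
  T \in unitmx -> T *m A = G *m T -> char_poly A = char_poly G.
Proof.
move=> Tu TA; pose TX := map_mx polyC T.
have : TX *m char_poly_mx A = char_poly_mx G *m TX.
  by rewrite mulmxBr mulmxBl scalar_mxC -!map_mxM /= TA.
move/(congr1 (@determinant _ _)); rewrite !det_mulmx mulrC => /mulIf; apply.
by rewrite det_map_mx polyC_eq0 -unitfE -unitmxE.
Qed.

Lemma char_poly_replace_row (R : comNzRingType) n (A G : 'M[R]_n)
    (k : 'I_n) (l : R) :
  (forall i j, i != k -> G i j = A i j) -> (forall i, A i k = 0) -> G k k = l ->
  'X * char_poly G = ('X - l%:P) * char_poly A.
Proof.
move=> GA Ak Gk; rewrite /char_poly !(expand_det_col _ k) (bigD1 k) //= big1.
  rewrite (bigD1 k) //= [X in _ = _ * (_ + X)]big1.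
    rewrite !addr0 !mxE eqxx Gk Ak polyC0 subr0 mulr1n mulrCA.
    congr (_ * (_ * _)).
    rewrite /cofactor; congr (_ * \det _); apply/matrixP => i j; rewrite !mxE.
    by rewrite GA // eq_sym neq_lift.
  by move=> i ik; rewrite !mxE (negPf ik) Ak mulr0n subrr mul0r.
by move=> i ik; rewrite !mxE (negPf ik) GA // Ak mulr0n subrr mul0r.
Qed.

Section Chains.
Variables (R : realType) (B : nat).
Implicit Types (F A : 'M[R]_B.+1) (x y : 'cV[R]_B.+1).

(** [A] acts by [l] on the line of [x], and [ratio_diff] identifies its action
    modulo that line with [A']; adding units on the diagonal at the positions
    from [k] on completes [ratio_diff] to an invertible change of basis, in
    which [A] becomes [A'] up to the row [k].  The factors [X] on the left and
    [X - l] on the right account for the eigenvalues of [A'] and [A] at the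
    position [k]. *)
Lemma char_poly_deflation (k : 'I_B.+1) A A' x l :
  pos_vec k.+1 x -> (forall i : 'I_B.+1, (k < i)%N -> x i 0 = 0) ->
  (forall i j : 'I_B.+1, (k < i)%N -> A i j = 0) ->
  (forall i j : 'I_B.+1, (k <= j)%N -> A' i j = 0) ->
  A *m x = l *: x -> ratio_diff k.+1 x *m A = A' *m ratio_diff k.+1 x ->
  'X * char_poly A = ('X - l%:P) * char_poly A'.
Proof.
move=> x0 xk Ak A'k Ax DA; set D := ratio_diff k.+1 x in DA *.
pose Dl : 'M[R]_B.+1 := diag_mx (\row_i (k <= i)%N%:R).
pose T := D + Dl.
have TE i j : T i j = (if (i < k)%N then
     ((j == i :> nat)%:R - (j == i.+1 :> nat)%:R) / x j 0 else (i == j)%:R).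
  by rewrite !mxE ltnS; case: ltnP => _; rewrite ?mul0rn ?addr0 ?add0r.
have Tu : T \in unitmx.
  rewrite unitmxE (@det_triangular_rank _ _ _ val) => [|i j ij ji].
    rewrite unitfE; apply/prodf_neq0 => i _; rewrite TE.
    case: ltnP => ik; last by rewrite eqxx oner_eq0.
    rewrite eqxx (ltn_eqF (ltnSn i)) subr0 mul1r invr_eq0 lt0r_neq0 // x0 //.
    by rewrite ltnS ltnW.
  have ji' : (j < i)%N by rewrite ltn_neqAle ji andbT eq_sym; exact: ij.
  rewrite TE (negPf ij) (ltn_eqF ji') (ltn_eqF (leqW ji')).
  by rewrite subrr mul0r if_same.
have TA : T *m A = A' *m T + Dl *m A.
  rewrite mulmxDl DA mulmxDr -addrA; congr (_ + _).
  rewrite (_ : A' *m Dl = 0) ?add0r //; apply/matrixP => i j.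
  rewrite mul_mx_diag !mxE; case: leqP => kj; last by rewrite mulr0.
  by rewrite A'k // mul0r.
pose G := A' + Dl *m A *m invmx T.
rewrite (@char_poly_similar _ _ T A G) //; last first.
  by rewrite TA mulmxDl mulmxKV.
have DlA i j : i != k -> (Dl *m A) i j = 0.
  move=> ik; rewrite mul_diag_mx !mxE; case: leqP => ki; last by rewrite mul0r.
  by rewrite Ak ?mulr0 // ltn_neqAle eq_sym ki andbT.
apply: (@char_poly_replace_row _ _ _ _ k).
- move=> i j ik; rewrite mxE [X in _ + X]mxE big1 ?addr0 // => m _.
  by rewrite DlA ?mul0r.
- by move=> i; rewrite A'k.
have xk0 : x k 0 != 0 by rewrite lt0r_neq0 ?x0.
have Tx : T *m x = x k 0 *: delta_mx k 0.
  apply/colP => i; rewrite !mxE eqxx andbT.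
  have [ik|ki] := ltnP i k; last first.
    rewrite (bigD1 i) //= TE ltnNge ki /= eqxx mul1r big1 ?addr0 => [|j ji].
      have [->|ik] := eqVneq i k; first by rewrite mulr1.
      by rewrite xk ?mulr0 // ltn_neqAle eq_sym ki andbT; exact: ik.
    by rewrite TE ltnNge ki /= eq_sym (negPf ji) mul0r.
  have iB : (i.+1 < B.+1)%N by have := ltn_ord k; lia.
  rewrite (bigD1 i) //= (bigD1 (Ordinal iB)) /=; last first.
    by apply/eqP => /(congr1 val) /=; lia.
  rewrite big1 ?addr0 => [|j /andP[ji ji1]].
    rewrite !TE ik /= !eqxx (gtn_eqF (ltnSn i)) (ltn_eqF (ltnSn i)) subr0 sub0r.
    have xn0 (j : 'I_B.+1) : (j <= k)%N -> x j 0 != 0.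
      by move=> jk; rewrite lt0r_neq0 ?x0.
    rewrite mulN1r mulNr mul1r !mulVf ?xn0 //; last by rewrite ltnW.
    rewrite subrr (_ : i == k = false) ?mulr0 //.
    by apply/negbTE/eqP => e; rewrite e ltnn in ik.
  have -> : T i j = 0.
    have n1 : (j == i :> nat) = false by apply/negbTE.
    have n2 : (j == i.+1 :> nat) = false by apply/negbTE.
    by rewrite TE ik n1 n2 subrr mul0r.
  by rewrite mul0r.
have Tk : invmx T *m delta_mx k 0 = (x k 0)^-1 *: x.
  by apply: (canLR (mulKmx Tu)); rewrite -scalemxAr Tx scalerA mulVf ?scale1r.
rewrite mxE A'k // add0r.
have -> : (Dl *m A *m invmx T) k k =
    (Dl *m (A *m (invmx T *m (delta_mx k 0 : 'cV_B.+1)))) k 0.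
  by rewrite !mulmxA -colE [RHS]mxE.
rewrite Tk -scalemxAr Ax scalerA mul_diag_mx !mxE leqnn mul1r.
by rewrite mulrAC mulVf ?mul1r.
Qed.

(** A sequence of composable truncated factors, each with its type, leading from
    size [n'] to size [n] through sizes [m] and [m + 1] only.  The lower bound
    [m] is what lets a path stay at each of the first [m] indices throughout. *)
Fixpoint bidiag_chain (m n : nat) (s : seq (bool * 'M[R]_B.+1)) (n' : nat) :
    Prop :=
  (m <= n <= m.+1)%N /\
  if s is (b, F) :: s' then
    exists n1, [/\ bidiag_sizes b n n1, pos_bidiag b n n1 F
                 & bidiag_chain m n1 s' n']
  else n = n'.

Definition chain_prod (s : seq (bool * 'M[R]_B.+1)) : 'M[R]_B.+1 :=
  foldr (fun bF A => bF.2 *m A) 1%:M s.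

Lemma bidiag_chain_sizes m n s n' : bidiag_chain m n s n' ->
  (m <= n <= m.+1)%N /\ (m <= n' <= m.+1)%N.
Proof.
elim: s n => [|[b F] s IH] n /= [mn]; first by move=> <-.
by case=> n1 [_ _ /IH[]].
Qed.

(** Deflation is compatible with composition: the vector used at each factor is
    the image of [x] under the factors to its right. *)
Lemma chain_deflation m n s n' x :
  bidiag_chain m.+1 n s n' -> (m.+2 <= B.+1)%N -> pos_vec n' x ->
  pos_vec n (chain_prod s *m x) /\
  exists s', [/\ map fst s' = map fst s, bidiag_chain m n.-1 s' n'.-1 &
    ratio_diff n (chain_prod s *m x) *m chain_prod s =
    chain_prod s' *m ratio_diff n' x].
Proof.
move=> + mB x0; elim: s n => [|[b F] s IH] n /= [mn].
  move=> nn'; rewrite nn' mul1mx mulmx1; split=> //; exists [::].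
  by rewrite /= mul1mx; split=> //; split=> //; lia.
case=> n1 [bs Fp ch]; have [n1m _] := bidiag_chain_sizes ch.
have [y0 [s' [ts' ch' E]]] := IH _ ch.
rewrite -!mulmxA; split; first by apply: pos_bidiag_mul_cV Fp y0 => //; lia.
have [n1_gt0 nB n1B] : [/\ 0 < n1, n <= B.+1 & n1 <= B.+1]%N by split; lia.
have [F' F'p DF] := pos_bidiag_deflation bs n1_gt0 nB n1B Fp y0.
exists ((b, F') :: s'); split => /=; first by rewrite ts'.
  split; first by lia.
  by exists n1.-1; split => //; move: bs; rewrite /bidiag_sizes; case: (b); lia.
by rewrite mulmxA DF -!mulmxA E.
Qed.

Lemma chain_prod_ge0 m n s n' : bidiag_chain m n s n' ->
  forall i j, 0 <= chain_prod s i j.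
Proof.
elim: s n => [|[b F] s IH] n /=; first by move=> _ i j; rewrite mxE ler0n.
case=> _ [n1 [_ Fp /IH Ps]] i j; rewrite mxE sumr_ge0 // => k _.
by rewrite mulr_ge0 ?Ps // (pos_bidiag_ge0 Fp).
Qed.

Lemma chain_prod_row0 m n s n' : bidiag_chain m n s n' -> s != [::] ->
  forall i j : 'I_B.+1, (n <= i)%N -> chain_prod s i j = 0.
Proof.
case: s => // -[b F] s /= [_ [n1 [_ Fp _]]] _ i j ni.
rewrite mxE big1 // => k _; rewrite (sg_bool_eq0 (Fp i k)) ?mul0r //.
by rewrite /bidiag_pattern ltnNge ni.
Qed.

Lemma chain_prod_col0 m n s n' : bidiag_chain m n s n' -> s != [::] ->
  forall i j : 'I_B.+1, (n' <= j)%N -> chain_prod s i j = 0.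
Proof.
elim: s n => // -[b F] s IH n /= [_ [n1 [_ Fp ch]]] _ i j nj.
rewrite mxE big1 // => k _.
have [s0|/eqP s0] := eqVneq s [::]; last first.
  by rewrite (IH _ ch) ?mulr0 //; apply/eqP.
move: ch; rewrite s0 /= => -[_ n1E]; rewrite mxE.
have [kj|_] := eqVneq k j; last by rewrite mulr0.
rewrite (sg_bool_eq0 (Fp i k)) ?mul0r // /bidiag_pattern kj.
rewrite -n1E in nj; rewrite [(j < n1)%N]ltnNge nj andbF //.
Qed.

Lemma mulmx_entry_gt0 A F (k i j : 'I_B.+1) :
  (forall i j, 0 <= A i j) -> (forall i j, 0 <= F i j) ->
  0 < A i k -> 0 < F k j -> 0 < (A *m F) i j.
Proof.
move=> A0 F0 Aik Fkj; rewrite mxE (bigD1 k) //=; apply: ltr_wpDr.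
  by rewrite sumr_ge0 // => l _; rewrite mulr_ge0.
exact: mulr_gt0.
Qed.

(** An entry of the product is positive when a path of factors realizes it:
    diagonal steps everywhere, except for one step at a lower (resp. upper)
    factor to go down (resp. up) by one. *)
Lemma chain_prod_gt0 m n s n' (i j : 'I_B.+1) : bidiag_chain m n s n' ->
  (i < m)%N -> (j < m)%N ->
  [|| i == j, (true \in map fst s) && (i == j.+1 :> nat)
    | (false \in map fst s) && (j == i.+1 :> nat)] ->
  0 < chain_prod s i j.
Proof.
elim: s n i j => [|[b F] s IH] n i j /=.
  by move=> _ _ _; rewrite !orbF => /eqP ->; rewrite mxE eqxx ltr01.
case=> mn [n1 [bs Fp ch]] im jm; have [n1m _] := bidiag_chain_sizes ch.
have F0 := pos_bidiag_ge0 Fp; have s0 := chain_prod_ge0 ch.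
have Fii : 0 < F i i.
  by apply: (sg_bool_gt0 (Fp i i)); rewrite /bidiag_pattern eqxx; lia.
have same_row c : [|| i == j, (true \in map fst s) && (i == j.+1 :> nat)
    | (false \in map fst s) && (j == i.+1 :> nat)] = c -> c ->
    0 < (F *m chain_prod s) i j.
  move=> <- h; apply: (mulmx_entry_gt0 F0 s0 Fii).
  exact: (IH _ _ _ ch im jm h).
have via_F : bidiag_pattern b n n1 i j -> 0 < (F *m chain_prod s) i j.
  move=> h; apply: (mulmx_entry_gt0 F0 s0 (sg_bool_gt0 (Fp i j) h)).
  by apply: (IH _ _ _ ch jm jm); rewrite eqxx.
rewrite !in_cons; case/or3P => [ij|/andP[/orP[bT|ts] ij]|/andP[/orP[bT|ts] ij]].
- by apply: (same_row _ _ isT); rewrite ij.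
- by apply: via_F; rewrite /bidiag_pattern -(eqP bT) ij orbT; lia.
- by apply: (same_row _ _ isT); rewrite ts ij orbT.
- by apply: via_F; rewrite /bidiag_pattern -(eqP bT) ij orbT; lia.
- by apply: (same_row _ _ isT); rewrite ts ij !orbT.
Qed.

Lemma chain_scale m n b F s n' l : 0 < l -> bidiag_chain m n ((b, F) :: s) n' ->
  bidiag_chain m n ((b, l *: F) :: s) n'.
Proof.
move=> l0 [mn [n1 [bs Fp ch]]]; split => //; exists n1; split => // i k.
by rewrite mxE sgrM Fp gtr0_sg // mul1r.
Qed.

Lemma tridiag_pow_gt0 m A :
  (forall i j, 0 <= A i j) ->
  (forall i j : 'I_B.+1, (i < m)%N -> (j < m)%N ->
     [|| i == j, i == j.+1 :> nat | j == i.+1 :> nat] -> 0 < A i j) ->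
  forall t (i j : 'I_B.+1), (i < m)%N -> (j < m)%N ->
    (i <= j + t)%N -> (j <= i + t)%N -> 0 < (A ^+ t) i j.
Proof.
move=> A0 Ap; elim=> [|t IH] i j im jm ij ji.
  have -> : i = j by apply: val_inj => /=; lia.
  by rewrite expr0 mxE eqxx ltr01.
have At0 k : forall i j, 0 <= (A ^+ k) i j.
  elim: k => [|k IHk] i' j'; first by rewrite expr0 mxE ler0n.
  by rewrite exprS mxE sumr_ge0 // => l _; rewrite mulr_ge0.
rewrite exprS -mulmxE.
pose k := if (i < j)%N then i.+1 else if (j < i)%N then i.-1 else (i : nat).
have kB : (k < B.+1)%N.
  by have := ltn_ord i; have := ltn_ord j; rewrite /k; case: (ltngtP i j); lia.
have km : (k < m)%N by rewrite /k; case: (ltngtP i j); lia.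
apply: (@mulmx_entry_gt0 _ _ (Ordinal kB)) => //.
  by apply: Ap => //=; rewrite -val_eqE /= /k; case: (ltngtP i j); lia.
by apply: IH => //=; rewrite /k; case: (ltngtP i j); lia.
Qed.

(** The deflated chain starts with the factor scaled by [l], since the chain of
    vectors closes up only to [A *m x = l *: x]. *)
Theorem chain_char_poly m s : bidiag_chain m m s m -> (m < B.+1)%N ->
  true \in map fst s -> false \in map fst s ->
  exists mu : seq R, [/\ size mu = m, all (fun u => 0 < u) mu &
    char_poly (chain_prod s) = 'X^(B.+1 - m) * \prod_(u <- mu) ('X - u%:P)].
Proof.
elim: m s => [|m IH] s ch mB sT sF; have s0 : s != [::] by case: (s) sT.
  exists [::]; split => //; rewrite big_nil mulr1 subn0.
  have -> : chain_prod s = 0.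
    by apply/matrixP => i j; rewrite (chain_prod_row0 ch) // mxE.
  by rewrite /char_poly /char_poly_mx map_mx0 subr0 det_scalar.
set A := chain_prod s.
have A0 : forall i j, 0 <= A i j := chain_prod_ge0 ch.
have Ap : forall i j : 'I_B.+1, (i < m.+1)%N -> (j < m.+1)%N ->
     [|| i == j, i == j.+1 :> nat | j == i.+1 :> nat] -> 0 < A i j.
  by move=> i j im jm h; apply: (chain_prod_gt0 ch) => //; rewrite sT sF.
pose k : 'I_B.+1 := Ordinal (ltnW mB).
have [|||x [l [l0 x0 xS Ax]]] :=
    @perron_on_support _ _ A (fun i : 'I_B.+1 => (i < m.+1)%N) B k A0.
- by move=> i j; rewrite -leqNgt => mi; apply: (chain_prod_row0 ch).
- move=> i j im jm; apply: (tridiag_pow_gt0 A0 Ap) => //.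
    by have := ltn_ord i; lia.
  by have := ltn_ord j; lia.
- by apply: Ap; rewrite ?eqxx //=.
have [_ [[|[b F] s'] [ts' ch' E]]] := chain_deflation ch mB x0.
  by move: sT; rewrite -ts'.
have DA : ratio_diff m.+1 x *m A =
    chain_prod ((b, l *: F) :: s') *m ratio_diff m.+1 x.
  have Dl : ratio_diff m.+1 (A *m x) = l^-1 *: ratio_diff m.+1 x.
    rewrite Ax; apply/matrixP => i j; rewrite !mxE invfM.
    by case: ifP => _; rewrite ?mulr0 // mulrCA.
  move: E; rewrite -/A Dl -scalemxAl => /(congr1 ( *:%R l)).
  rewrite scalerA mulfV ?lt0r_neq0 // scale1r => ->.
  by rewrite scalemxAl /= scalemxAl.
have chl := chain_scale l0 ch'.
have tE : map fst ((b, l *: F) :: s') = map fst s := ts'.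
have [||mu [mu_m mu0 cP]] := IH _ chl (ltnW mB); rewrite ?tE //.
exists (l :: mu); split; rewrite /= ?mu_m ?l0 //.
apply: (mulfI (negbT (polyX_eq0 R))).
rewrite (@char_poly_deflation k A _ x l x0 _ _ _ Ax DA).
- rewrite cP big_cons (_ : B.+1 - m = (B.+1 - m.+1).+1)%N; last by lia.
  by rewrite exprS -mulrA mulrCA; congr (_ * _); rewrite mulrCA.
- by move=> i mi; apply: xS; rewrite -leqNgt.
- by move=> i j mi; apply: (chain_prod_row0 ch).
- by move=> i j mj; apply: (chain_prod_col0 chl).
Qed.

End Chains.

(** * Residues, copies and coordinate states *)

Section Arithmetic.
Variables p q : nat.
Hypotheses (hp : (1 <= p)%N) (hq : (1 <= q)%N).
Local Notation d := (gcdn p q).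
Local Notation P := (redP p q).
Local Notation Q := (redQ p q).
Local Notation rR := (redR p q).
Local Notation M := (p + q)%N.
Local Open Scope nat_scope.

Lemma gcd_pq_gt0 : 0 < d. Proof. by rewrite gcdn_gt0 hp. Qed.

Lemma redPE : p = P * d. Proof. by rewrite /redP divnK ?dvdn_gcdl. Qed.
Lemma redQE : q = Q * d. Proof. by rewrite /redQ divnK ?dvdn_gcdr. Qed.

Lemma redP_gt0 : 0 < P.
Proof. by have := hp; rewrite {1}redPE muln_gt0 => /andP[]. Qed.
Lemma redQ_gt0 : 0 < Q.
Proof. by have := hq; rewrite {1}redQE muln_gt0 => /andP[]. Qed.
Lemma redR_gt0 : 0 < rR. Proof. by rewrite /redR addn_gt0 redP_gt0. Qed.

Lemma num_copiesE : M = d * rR.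
Proof. by rewrite /redR mulnDr !(mulnC d) -redPE -redQE. Qed.

Lemma coprime_redR : coprime rR Q.
Proof.
rewrite /redR /coprime gcdnC gcdnDr gcdnC -(eqn_pmul2r gcd_pq_gt0) mul1n.
by rewrite muln_gcdl -redPE -redQE.
Qed.

Lemma rmd_lt k : rmd p q k < rR. Proof. by rewrite ltn_mod redR_gt0. Qed.

Lemma rmdS k : rmd p q k.+1 =
  if rmd p q k < P then rmd p q k + Q else rmd p q k - P.
Proof.
have rk := rmd_lt k; rewrite {1}/rmd mulSn addnC -modnDml -/(rmd p q k).
have RE : rR = P + Q by [].
case: ltnP => rP; first by rewrite modn_small //; lia.
rewrite -[X in X %% _](@subnK rR); last by lia.
by rewrite modnDr modn_small; lia.
Qed.

Lemma rmd_addR k i : rmd p q (i * rR + k) = rmd p q k.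
Proof. by rewrite /rmd mulnDl mulnAC modnMDl. Qed.

Lemma rmd_modM k : rmd p q (k %% M) = rmd p q k.
Proof.
by rewrite [in RHS](divn_eq k M) [X in _ * X + _]num_copiesE mulnA rmd_addR.
Qed.

Lemma rmd_inj i j : i < rR -> j < rR -> rmd p q i = rmd p q j -> i = j.
Proof.
wlog ij : i j / i <= j.
  move=> h iR jR e.
  by case: (leqP i j) => [/h|/ltnW/h] h'; [|symmetry]; apply: h'.
move=> iR jR /eqP; rewrite eq_sym eqn_mod_dvd ?leq_mul2r ?ij ?orbT // -mulnBl.
rewrite Gauss_dvdl ?coprime_redR // => /dvdnP[[|c]]; lia.
Qed.

Definition rmd_ord (i : 'I_rR) : 'I_rR := Ordinal (rmd_lt i).

Lemma rmd_ord_inj : injective rmd_ord.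
Proof.
by move=> i j /(congr1 val) /= /rmd_inj e; apply/val_inj/e.
Qed.

Lemma rmd_surj r : r < rR -> exists2 k, k < rR & rmd p q k = r.
Proof.
move=> rr; exists (invF rmd_ord_inj (Ordinal rr)); first exact: ltn_ord.
by have /(congr1 val) := f_invF rmd_ord_inj (Ordinal rr).
Qed.

(** Hermite's identity: raising [n] by one shifts the summands cyclically, and
    raises by one the summand that wraps around. *)
Lemma sum_divn_shift n r : 0 < r -> \sum_(0 <= i < r) (n + i) %/ r = n.
Proof.
move=> r0; elim: n => [|n IH].
  by rewrite big_nat big1 // => i /andP[_ ir]; rewrite add0n divn_small.
apply: (@addnI (n %/ r)).
have -> : \sum_(0 <= i < r) (n.+1 + i) %/ r = \sum_(1 <= i < r.+1) (n + i) %/ r.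
  by rewrite big_add1 /=; apply: eq_bigr => i _; rewrite addSnnS.
have -> : n %/ r + \sum_(1 <= i < r.+1) (n + i) %/ r =
    \sum_(0 <= i < r.+1) (n + i) %/ r by rewrite [RHS]big_ltn // addn0.
rewrite big_nat_recr //= IH divnDr ?dvdnn // divnn r0.
by rewrite addn1 addnS addnC addnS.
Qed.

(** The number of [n] with [rmd k + n * R <= N], as [copy_sizeP] shows; adding
    [R] before dividing makes the formula right when the offset exceeds [N]. *)
Definition copy_size (N k : nat) : nat := (N + rR - rmd p q k) %/ rR.

(** Over each of the [d] periods the offsets run through all residues. *)
Lemma sum_copy_size N : \sum_(0 <= k < M) copy_size N k = d * N.+1.
Proof.
rewrite num_copiesE big_nat_mul (eq_bigr (fun=> N.+1)).
  by rewrite sum_nat_const_nat subn0.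
move=> i _.
rewrite -{1}[i * rR]add0n big_addn mulSn addnK.
rewrite big_mkord.
transitivity (\sum_(k < rR) (N + rR - k) %/ rR).
  rewrite [RHS](reindex_inj rmd_ord_inj) /=; apply: eq_bigr => k _.
  by rewrite /copy_size [X in rmd _ _ X]addnC rmd_addR.
rewrite -[RHS](sum_divn_shift N.+1 redR_gt0) big_mkord.
rewrite [RHS](reindex_inj rev_ord_inj) /=.
by apply: eq_bigr => k _; congr (_ %/ _); have := ltn_ord k; lia.
Qed.

Lemma copy_size_bounds N k :
  N.+1 %/ rR <= copy_size N k <= (N.+1 %/ rR).+1.
Proof.
have rk := rmd_lt k; apply/andP; split; first by apply: leq_div2r; lia.
have -> : (N.+1 %/ rR).+1 = (N.+1 + rR) %/ rR.
  by rewrite divnDr ?dvdnn // divnn redR_gt0 addn1.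
by apply: leq_div2r; lia.
Qed.

Lemma copy_size_modM N k : copy_size N (k %% M) = copy_size N k.
Proof. by rewrite /copy_size rmd_modM. Qed.

Lemma copy_sizeP N k n : (n < copy_size N k) = (rmd p q k + n * rR <= N).
Proof.
have rk := rmd_lt k; rewrite /copy_size leq_divRL ?redR_gt0 // mulSn; lia.
Qed.

Lemma copy_size_step N k :
  bidiag_sizes (rmd p q k < P) (copy_size N k) (copy_size N k.+1).
Proof.
have rk := rmd_lt k; have rk1 := rmd_lt k.+1; have RE : rR = P + Q by [].
have S x : (x %/ rR).+1 = (x + rR) %/ rR.
  by rewrite divnDr ?dvdnn // divnn redR_gt0 addn1.
rewrite /bidiag_sizes /copy_size !S rmdS; rewrite rmdS in rk1.
by case: (ltnP (rmd p q k) P) rk1 => rP rk1; rewrite !leq_div2r //; lia.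
Qed.

Lemma num_copies_gt0 : 0 < M. Proof. by rewrite addn_gt0 hp. Qed.

(** The [n]-th state of a copy.  Copies are counted from 0 and [k] is any
    natural number, taken modulo the number of copies: paths through the cyclic
    structure then run over consecutive integers. *)
Definition copy_state (k n : nat) : nat * nat :=
  (rmd p q k + n * rR, (k %% M).+1).

Lemma copy_state_modM k n : copy_state (k %% M) n = copy_state k n.
Proof. by rewrite /copy_state rmd_modM modn_mod. Qed.

Lemma is_state_copy_state k n : is_state p q (copy_state k n).
Proof.
rewrite /is_state /= ltn_mod num_copies_gt0 /omega /= rmd_modM leq_addr /=.
by rewrite addKn dvdn_mull.
Qed.

Lemma state_index_copy_state k n : state_index p q (copy_state k n) = n.
Proof. by rewrite /state_index /omega /= rmd_modM addKn mulnK ?redR_gt0. Qed.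

Lemma is_stateE s : is_state p q s -> s = copy_state s.2.-1 (state_index p q s).
Proof.
case: s => h j /and3P[/= /andP[j0 jM] wh dv].
rewrite /copy_state /state_index /=.
by rewrite divnK // /omega subnKC // modn_small prednK.
Qed.

Lemma next_copy_copy_state k n n' :
  (copy_state k.+1 n').2 = next_copy p q (copy_state k n).2.
Proof.
rewrite /next_copy /= -[k.+1]addn1 -modnDml addn1.
have := ltn_pmod k num_copies_gt0; rewrite leq_eqVlt => /orP[/eqP e|lt].
  by rewrite e modnn ltnn.
by rewrite lt modn_small.
Qed.

Lemma states_uniq N : uniq (states p q N).
Proof.
by apply/filter_uniq/allpairs_uniq; rewrite ?iota_uniq // => -[a b] [c e] _ _.
Qed.

Lemma mem_states N s : (s \in states p q N) = is_state p q s && (s.1 <= N).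
Proof.
rewrite mem_filter; case E: (is_state p q s) => //; rewrite !andTb.
case/and3P: E => jM _ _.
apply/allpairsP/idP => [[[h j] [+ _ ->]]|sN]; first by rewrite mem_iota ltnS.
by exists s; rewrite !mem_iota ltnS sN add1n ltnS jM; split => //; case: (s).
Qed.

Lemma mem_copy_state N k n :
  (copy_state k n \in states p q N) = (n < copy_size N k).
Proof. by rewrite mem_states is_state_copy_state copy_sizeP. Qed.

Lemma copy_states N k : perm_eq [seq s <- states p q N | s.2 == (k %% M).+1]
  [seq copy_state k n | n <- iota 0 (copy_size N k)].
Proof.
apply: uniq_perm; first by rewrite filter_uniq ?states_uniq.
  rewrite map_inj_uniq ?iota_uniq // => n n' /(congr1 (state_index p q)).
  by rewrite !state_index_copy_state.
move=> s; rewrite mem_filter; apply/andP/mapP => [[/eqP e sN]|[n + ->]].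
  have /is_stateE E : is_state p q s by move: sN; rewrite mem_states => /andP[].
  move: E; rewrite e /= copy_state_modM => E.
  by exists (state_index p q s) => //; rewrite mem_iota /= -mem_copy_state -E.
by rewrite mem_iota /= -mem_copy_state => ->.
Qed.

Lemma size_states N : size (states p q N) = d * N.+1.
Proof.
rewrite -sum_copy_size big_mkord -sum1_size.
rewrite (eq_big_seq (fun s => \sum_(k < M) (s.2 == k.+1)%N)) => [|s].
  rewrite exchange_big /=; apply: eq_bigr => k _.
  have := perm_size (copy_states N k); rewrite size_map size_iota => <-.
  rewrite size_filter modn_small ?ltn_ord // -sum1_count [RHS]big_mkcond /=.
  by apply: eq_bigr => s _; case: eqP.
rewrite mem_states => /andP[/and3P[/andP[j0 jM] _ _] _].
have kM : s.2.-1 < M by rewrite prednK.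
rewrite (bigD1 (Ordinal kM)) //= prednK // eqxx big1 ?addn0 // => k kj.
case: eqP => // e; case/eqP: kj; apply: val_inj; by rewrite /= e.
Qed.

Lemma big_state (T : Type) (idx : T) (op : Monoid.law idx) N
    (f : nat * nat -> T) :
  \big[op/idx]_(i < size (states p q N)) f (state i) =
  \big[op/idx]_(s <- states p q N) f s.
Proof. by rewrite [RHS](big_nth (0, 0)) big_mkord. Qed.

Lemma card_copy_set N c : 1 <= c <= M -> #|copy_set p q N c| = copy_size N c.-1.
Proof.
move=> /andP[c0 cM]; rewrite cardsE -sum1_card big_mkcond /=.
have := perm_size (copy_states N c.-1).
rewrite size_map size_iota modn_small prednK // => <-.
rewrite [RHS]size_filter -[RHS]sum1_count [RHS]big_mkcond /=.
by rewrite -(@big_state _ _ addn N (fun s => if s.2 == c then 1 else 0)).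
Qed.

End Arithmetic.

(** * Powers of the truncated matrix as products of factors *)

Section Link.
Variables (R : realType) (p q : nat).
Hypotheses (hp : (1 <= p)%N) (hq : (1 <= q)%N).
Variables (Ft : seq (smx R)) (N : nat).
Hypothesis hw : has_type_word Ft (sigma_min p q).
Local Notation M := (p + q)%N.
Local Notation m := (N.+1 %/ redR p q)%N.
Local Notation K := (Kmx p q Ft N).

(** The block of [Kmx] from copy [k] to the next one, in the state indices of
    the two copies, padded with zeros to the order [m + 1]. *)
Definition padded_factor (k : nat) : 'M[R]_m.+1 :=
  \matrix_(n, l)
    if (n < copy_size p q N k)%N && (l < copy_size p q N k.+1)%N
    then Hmx p q Ft (copy_state p q k n) (copy_state p q k.+1 l) else 0.

Definition factor_chain (k t : nat) : seq (bool * 'M[R]_m.+1) :=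
  [seq ((rmd p q j < redP p q)%N, padded_factor j) | j <- iota k t].

(** From copy [k] to the next one the offset changes by [Q] or by [- P].
    A step by [Q] in height therefore keeps the index at a lower factor and
    raises it at an upper one, and a step by [- P] lowers it, resp. keeps it. *)
Lemma Hmx_copy_state k n l :
  Hmx p q Ft (copy_state p q k n) (copy_state p q k.+1 l) =
  let F := nth (fun _ _ => 0) Ft (k %% M) in
  if (rmd p q k < redP p q)%N
  then if (l == n)%N then 1 else if (n == l.+1)%N then F n l else 0
  else if (l == n.+1)%N then 1 else if (l == n)%N then F n n else 0.
Proof.
have kM : (k %% M < M)%N by rewrite ltn_mod num_copies_gt0.
rewrite /Hmx -(next_copy_copy_state q hp k n l) eqxx.
rewrite state_index_copy_state //= nth_mkseq // rmd_modM //.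
have rS := rmdS hp hq k; rewrite /= in rS *.
have R0 := redR_gt0 q hp; have rk := rmd_lt q hp k.
have RE : redR p q = (redP p q + redQ p q)%N by [].
rewrite rS; case: ltnP => rP.
  rewrite [(rmd p q k + redQ p q + _)%N]addnAC !eqn_add2r eqn_add2l.
  rewrite eqn_pmul2r //.
  case: eqP => // _.
  have -> : (rmd p q k + l * redR p q + redQ p q + redP p q ==
             rmd p q k + n * redR p q)%N = (n == l.+1)%N.
    rewrite -!addnA eqn_add2l (addnC (redQ _ _)) -RE addnC -mulSn.
    by rewrite eqn_pmul2r // eq_sym.
  by case: eqP => // ->.
have -> : (rmd p q k - redP p q + l * redR p q ==
           rmd p q k + n * redR p q + redQ p q)%N = (l == n.+1)%N.
  rewrite -(eqn_add2r (redP p q)) addnAC subnK // -!addnA eqn_add2l.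
  by rewrite (addnC (redQ _ _)) -RE addnC -mulSn eqn_pmul2r.
case: eqP => // _.
by rewrite addnAC subnK // eqn_add2l eqn_pmul2r.
Qed.

Lemma pos_bidiag_padded_factor k :
  pos_bidiag (rmd p q k < redP p q)%N (copy_size p q N k) (copy_size p q N k.+1)
    (padded_factor k).
Proof.
move=> n l; rewrite mxE /bidiag_pattern andbA.
case: ifP => // _; last by rewrite sgr0.
rewrite Hmx_copy_state /=.
have kM : (k %% M < M)%N by rewrite ltn_mod num_copies_gt0.
have := hw.2 (k %% M)%N; rewrite size_mkseq nth_mkseq // rmd_modM // => /(_ kM).
case: ifP => _ [Fb F1 Fpos].
  case: (l == n :> nat); first by rewrite sgr1.
  case: eqP => [->|_]; last by rewrite sgr0.
  by rewrite gtr0_sg // Fpos.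
rewrite orbC; case: (l == n.+1 :> nat); first by rewrite sgr1.
case: (l == n :> nat); last by rewrite sgr0.
by rewrite gtr0_sg // Fpos.
Qed.

Lemma bidiag_chain_factor_chain t k :
  bidiag_chain m (copy_size p q N k) (factor_chain k t)
    (copy_size p q N (k + t)).
Proof.
elim: t k => [|t IH] k /=; split; rewrite ?copy_size_bounds ?addn0 //.
exists (copy_size p q N k.+1); split.
- exact: copy_size_step.
- exact: pos_bidiag_padded_factor.
- by rewrite addnS -addSn; exact: IH.
Qed.

Lemma copy_size_le k : (copy_size p q N k <= m.+1)%N.
Proof. by have /andP[] := copy_size_bounds hp hq N k. Qed.

Lemma state_copyE (i : 'I_(size (states p q N))) k :
  (state i).2 = (k %% M).+1 ->
  state i = copy_state p q k (state_index p q (state i)) /\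
  (state_index p q (state i) < copy_size p q N k)%N.
Proof.
move=> e; have iS : state i \in states p q N by apply: mem_nth.
have /is_stateE E : is_state p q (state i).
  by move: iS; rewrite mem_states => /andP[].
by move: E iS; rewrite e /= copy_state_modM => E; rewrite {1 2}E mem_copy_state.
Qed.

Lemma state_inj : injective (@state p q N).
Proof.
move=> i j e; apply/val_inj/eqP.
rewrite -(nth_uniq (0, 0)%N (ltn_ord i) (ltn_ord j) (states_uniq p q N)).
by rewrite -/(state i) e.
Qed.

Lemma inord_inj_le (b n n' : nat) : (n < b.+1)%N -> (n' < b.+1)%N ->
  ((inord n : 'I_b.+1) == inord n') = (n == n').
Proof. by move=> nb nb'; rewrite -val_eqE /= !inordK. Qed.

(** Paths of length [t] from copy [k] pass through the next [t] factors. *)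
Lemma Kmx_pow t k n (i j : 'I_(size (states p q N))) :
  state i = copy_state p q k n ->
  (K ^+ t) i j =
  if ((state j).2 == ((k + t) %% M).+1)%N
  then chain_prod (factor_chain k t) (inord n)
         (inord (state_index p q (state j)))
  else 0.
Proof.
elim: t k n i => [|t IH] k n i si.
  rewrite expr0 mxE addn0 mxE.
  have [|_] := @state_copyE i k; first by rewrite si.
  rewrite si state_index_copy_state // => nk.
  have [/state_copyE[sj jk]|sj] := eqVneq (state j).2 (k %% M).+1.
    rewrite inord_inj_le ?(leq_trans _ (copy_size_le k)) //.
    rewrite -(inj_eq state_inj) si sj.
    rewrite state_index_copy_state //; congr (_%:R); congr nat_of_bool.
    apply/eqP/eqP => [/(congr1 (state_index p q))|->//].
    by rewrite !state_index_copy_state.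
  by case: eqP => // e; case/eqP: sj; rewrite -e si.
rewrite exprS -mulmxE mxE.
pose f (s : nat * nat) := if (s.2 == (k.+1 %% M).+1)%N then
  Hmx p q Ft (copy_state p q k n) s *
  (if ((state j).2 == ((k.+1 + t) %% M).+1)%N
   then chain_prod (factor_chain k.+1 t) (inord (state_index p q s))
          (inord (state_index p q (state j)))
   else 0) else 0.
rewrite (eq_bigr (fun l => f (state l))) => [|l _]; last first.
  rewrite mxE si /f; case: eqP => [/state_copyE -[sl _]|sl].
    by rewrite (IH _ _ _ sl) sl.
  rewrite /Hmx -(next_copy_copy_state q hp k n 0) /=.
  by case: eqP => [//|_]; rewrite mul0r.
rewrite big_state -big_mkcond -big_filter.
rewrite (perm_big _ (copy_states hp hq N k.+1)) big_map addSnnS.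
case: eqP => _; last by rewrite big1 // => l _; rewrite mulr0.
rewrite /= mxE; under eq_bigr do rewrite state_index_copy_state //.
have nk : (n < copy_size p q N k)%N.
  by have [|_] := @state_copyE i k; rewrite si ?state_index_copy_state.
have nm := leq_trans nk (copy_size_le k).
pose h (l : nat) := Hmx p q Ft (copy_state p q k n) (copy_state p q k.+1 l) *
  chain_prod (factor_chain k.+1 t) (inord l)
    (inord (state_index p q (state j))).
transitivity (\sum_(l < copy_size p q N k.+1) h l).
  by rewrite -[X in iota 0 X]subn0 big_mkord.
rewrite (big_ord_widen m.+1 h (copy_size_le k.+1)) big_mkcond /h.
apply: eq_bigr => l _; rewrite inord_val mxE inordK // nk /=.
by case: ifP => _; rewrite ?mul0r.
Qed.

Lemma copy_size_exists_min : exists2 k, (k < M)%N & copy_size p q N k = m.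
Proof.
have R0 := redR_gt0 q hp.
have [|k kR kr] := @rmd_surj p q hp hq (redR p q).-1; first by rewrite prednK.
exists k.
  by apply: leq_trans kR _; rewrite (num_copiesE p q) leq_pmull // gcd_pq_gt0.
by rewrite /copy_size kr; congr (_ %/ _)%N; lia.
Qed.

(** On a copy with exactly [m] states the diagonal block of [Kmx ^+ M] is the
    product of the chain of all [M] factors starting there, without padding; the
    padding contributes one factor [X]. *)
Lemma char_poly_min_copy k : (k < M)%N -> copy_size p q N k = m ->
  exists mu : seq R, [/\ size mu = m, all (fun u => 0 < u) mu &
    char_poly (Cmx p q Ft N k.+1) = \prod_(u <- mu) ('X - u%:P)].
Proof.
move=> kM km; set s := factor_chain k M.
have ch : bidiag_chain m m s m.
  have := bidiag_chain_factor_chain M k.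
  by rewrite -(copy_size_modM _ _ _ (k + M)) modnDr copy_size_modM km.
have M0 := num_copies_gt0 q hp; have R0 := redR_gt0 q hp.
have P0 := redP_gt0 q hp; have Q0 := redQ_gt0 p hq.
have letter r : (r < redR p q)%N -> (r < redP p q)%N \in map fst s.
  move=> rR; have [k' k'R <-] := rmd_surj hp hq rR.
  rewrite -map_comp; apply/mapP.
  pose j := (k + (k' + (M - k)) %% M)%N.
  exists j; first by rewrite mem_iota leq_addr ltn_add2l ltn_pmod.
  rewrite /= -(rmd_modM _ _ j) /j modnDmr addnCA subnKC; last exact: ltnW.
  by rewrite modnDr rmd_modM.
have sT : true \in map fst s by rewrite -P0; apply: letter.
have sF : false \in map fst s.
  have -> : false = ((redR p q).-1 < redP p q)%N by rewrite /redR; lia.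
  by apply: letter; rewrite prednK.
have [|||mu [mum mu0 cP]] := chain_char_poly ch => //.
exists mu; split => //; move: cP; rewrite subSnn expr1.
set A := chain_prod s.
have kM1 : (1 <= k.+1 <= M)%N by [].
pose C := copy_set p q N k.+1.
pose e (i : 'I_#|C|) := state_index p q (state (enum_val i)).
have eP (i : 'I_#|C|) :
    state (enum_val i) = copy_state p q k (e i) /\ (e i < m)%N.
  have := enum_valP i; rewrite inE => /eqP h; rewrite -km; apply: state_copyE.
  by rewrite h modn_small.
pose g (i : 'I_#|C|) : 'I_m.+1 := inord (e i).
have gI : injective g.
  move=> i j /(congr1 val); rewrite /= !inordK ?(leqW (eP _).2) // => eij.
  by apply/enum_val_inj/state_inj; rewrite (eP i).1 (eP j).1 eij.
have cC : #|C| = m by rewrite card_copy_set.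
rewrite (@char_poly_mxsub_support _ _ _ A g gI); last first.
  move=> i j jg; apply: (chain_prod_col0 ch).
    by rewrite /s; case: (M) M0.
  rewrite leqNgt; apply: contra jg => jm.
  have [l lS sl] : exists2 l, (l < size (states p q N))%N &
      nth (0, 0)%N (states p q N) l = copy_state p q k j.
    by apply/nthP; rewrite mem_copy_state // km.
  have lC : Ordinal lS \in C by rewrite inE /state /= sl /= modn_small.
  apply/codomP; exists (enum_rank_in lC (Ordinal lS)); apply: val_inj.
  rewrite /g /e enum_rankK_in // /state /= sl.
  by rewrite state_index_copy_state // inordK.
have -> : (m.+1 - #|C| = 1)%N by rewrite cC subSnn.
rewrite expr1 => /(mulfI (negbT (polyX_eq0 R))) <-.
congr char_poly; apply/matrixP => i j; rewrite !mxE.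
have [si _] := eP i; rewrite (Kmx_pow _ _ si).
have [sj _] := eP j; rewrite modnDr {1}sj eqxx.
by [].
Qed.

End Link.

(** * Characteristic polynomials and poles *)

(** By Cramer's rule the characteristic polynomial is a common denominator. *)
Lemma mx_pole_resolvent_root (F : fieldType) n (A : 'M[F]_n) (z : F) :
  mx_pole (resolvent A) z -> root (char_poly A) z.
Proof.
case=> i [j]; apply: contra_notT => rz.
exists ((\adj (char_poly_mx A)) i j), (char_poly A); split; first by [].
have cA0 : tofrac (char_poly A) != 0 :> {fraction {poly F}}.
  by rewrite tofrac_eq0 monic_neq0 // char_poly_monic.
rewrite /resolvent /invmx unitmxE det_map_mx -/(char_poly A) unitfE cA0.
by rewrite -map_mx_adj !mxE mulrC.
Qed.

Lemma comp_polyXn_inj (R : idomainType) n : (0 < n)%N ->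
  injective (fun f : {poly R} => f \Po 'X^n).
Proof.
move=> n0 f g fg; apply/polyP => i.
have := congr1 (fun h : {poly R} => h`_(i * n)) fg.
by rewrite /= !coef_comp_poly_Xn // dvdn_mull // mulnK.
Qed.

Section CyclicSpectrum.
Variables (R : realType) (p q : nat).
Hypotheses (hp : (1 <= p)%N) (hq : (1 <= q)%N).
Variables (Ft : seq (smx R)) (N : nat).
Hypothesis hw : has_type_word Ft (sigma_min p q).
Local Notation M := (p + q)%N.
Local Notation D := (size (states p q N)).
Local Notation m := (N.+1 %/ redR p q)%N.
Local Notation K := (Kmx p q Ft N).

Lemma state_copy_bounds (i : 'I_D) : (1 <= (state i).2 <= M)%N.
Proof.
have : state i \in states p q N by apply: mem_nth.
by rewrite mem_states => /andP[/and3P[]].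
Qed.

Lemma char_poly_Kmx_copy c : (1 <= c <= M)%N ->
  'X^(M * #|copy_set p q N c|) * char_poly K =
  'X^D * (char_poly (Cmx p q Ft N c) \Po 'X^M).
Proof.
move=> cM; apply: (@char_poly_cyclic _ _ M K (fun i => (state i).2) _ c).
- exact: num_copies_gt0.
- move=> i j; rewrite mxE /Hmx.
  have [-> _|_] := eqVneq (state j).2 (next_copy p q (state i).2); last first.
    by rewrite eqxx.
  rewrite /next_copy; case: ltnP => // iM.
  have /andP[_ iM'] := state_copy_bounds i.
  have -> : (state i).2 = M by apply/eqP; rewrite eqn_leq iM iM'.
  by rewrite -[M.+1]addn1 modnDl.
move=> i; rewrite inE; have := state_copy_bounds i.
move: (state i).2 cM => a /andP[c0 cM] /andP[a0 aM].
apply/eqP/eqP => [->//|ac].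
have : (a.-1 + 1 == c.-1 + 1 %[mod M])%N by rewrite !addn1 !prednK // ac.
by rewrite eqn_modDr !modn_small ?prednK // => /eqP; lia.
Qed.

Lemma divn_num_states : ((gcdn p q * N.+1) %/ M = m)%N.
Proof. by rewrite (num_copiesE p q) divnMl ?gcd_pq_gt0. Qed.

(** A copy of minimal size fixes the polynomial; substituting [X^M] is
    injective, so [char_poly_Kmx_copy] transports it to all other copies. *)
Lemma cyclic_spectrum :
  exists mu : seq R, let P := \prod_(u <- mu) ('X - u%:P) in
  [/\ size mu = m, all (fun u => 0 < u) mu,
    char_poly K = 'X^(gcdn p q * N.+1 - M * m) * (P \Po 'X^M)
  & forall c, (1 <= c <= M)%N -> (m <= #|copy_set p q N c|)%N /\
      char_poly (Cmx p q Ft N c) = 'X^(#|copy_set p q N c| - m) * P].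
Proof.
have M0 := num_copies_gt0 q hp.
have [k kM km] := copy_size_exists_min hp hq N.
have [mu [mum mu0 cC]] := char_poly_min_copy hp hq hw kM km.
exists mu => P; rewrite -/P in cC.
have DM : (M * m <= gcdn p q * N.+1)%N.
  by rewrite -divn_num_states mulnC leq_trunc_div.
have cK : char_poly K = 'X^(gcdn p q * N.+1 - M * m) * (P \Po 'X^M).
  have kM1 : (1 <= k.+1 <= M)%N by [].
  have DE : 'X^D = 'X^(M * m) * 'X^(gcdn p q * N.+1 - M * m) :> {poly R}.
    by rewrite -exprD subnKC // -(size_states hp hq).
  have := char_poly_Kmx_copy kM1; rewrite cC card_copy_set //= km DE.
  rewrite -mulrA => /mulfI; apply.
  exact: monic_neq0 (monicXn _ _).
split => // c cM.
have mc : (m <= #|copy_set p q N c|)%N.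
  by rewrite card_copy_set //; have /andP[] := copy_size_bounds hp hq N c.-1.
split => //; apply: (comp_polyXn_inj M0).
apply: (@mulfI _ 'X^D); first exact: monic_neq0 (monicXn _ _).
rewrite -char_poly_Kmx_copy // cK comp_polyM comp_Xn_poly -exprM !mulrA -!exprD.
congr ('X^_ * _); rewrite mulnBr.
by have := size_states hp hq N; have := leq_mul (leqnn M) mc; lia.
Qed.

End CyclicSpectrum.

Theorem theorem6p13 (R : realType) (p q : nat)
  (hp : (1 <= p)%N) (hq : (1 <= q)%N)
  (L U : nat -> smx R)
  (hL : forall i, (1 <= i <= p)%N -> pos_lower (L i))
  (hU : forall i, (1 <= i <= q)%N -> pos_upper (U i))
  (a : nat) (ha : (a_minus p q <= a <= a_plus p q)%N)
  (Ft : seq (smx R))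
  (hFt : swaps (rot a.-1 (factors p q L U)) Ft)
  (hw : has_type_word Ft (sigma_min p q))
  (N : nat) :
  let M := (p + q)%N in
  let d := gcdn p q in
  let K := Kmx p q Ft N in
  let KC := map_mx (real_complex R) K in
  let m := ((d * N.+1) %/ M)%N in
  size (states p q N) = (d * N.+1)%N /\
  exists (r : nat) (P : {poly R}),
    let PC := map_poly (real_complex R) P in
    [/\ (r < M)%N, P.[0] != 0,
        char_poly K = 'X^r * (P \Po 'X^M)
      & r = (d * N.+1 - M * m)%N] /\
    [/\ size P = m.+1, m = (N.+1 %/ (redP p q + redQ p q))%N
      & forall y : R[i], root PC y -> 0 < y] /\
    (forall z : R[i], z != 0 -> mx_pole (resolvent KC) z ->
       exists zeta t : R[i], [/\ zeta ^+ M = 1, 0 <= t & z = t * zeta]) /\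
    (forall c, (1 <= c <= M)%N ->
       (m <= #|copy_set p q N c|)%N /\
       char_poly (Cmx p q Ft N c) = 'X^(#|copy_set p q N c| - m) * P) /\
    (forall c, (1 <= c <= M)%N -> #|copy_set p q N c| = m ->
       char_poly (Cmx p q Ft N c) = P) /\
    (forall y : R[i], root PC y <->
       y != 0 /\ exists2 z : R[i], eigenvalue KC z & y = z ^+ M).
Proof.
move=> M d K KC m.
have M0 : (0 < M)%N := num_copies_gt0 q hp.
have mE : m = (N.+1 %/ redR p q)%N := divn_num_states q hp N.
split; first exact: size_states.
have [mu [mum /allP mu0 cK cC]] := cyclic_spectrum hp hq N hw.
rewrite -/d -/M -/K -mE in mum cK cC.
set P := \prod_(u <- mu) ('X - u%:P) in cK cC.
exists (d * N.+1 - M * m)%N, P => PC.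
have PCE : PC = \prod_(u <- mu) ('X - (real_complex R u)%:P).
  rewrite /PC /P rmorph_prod; apply: eq_bigr => u _.
  by rewrite rmorphB /= map_polyX map_polyC.
have rootPC y : root PC y -> 0 < y.
  have -> : PC = \prod_(w <- map (real_complex R) mu) ('X - w%:P).
    by rewrite PCE big_map.
  by rewrite root_prod_XsubC => /mapP[u /mu0 u0 ->]; rewrite ltcR.
have cKC : char_poly KC = 'X^(d * N.+1 - M * m) * (PC \Po 'X^M).
  by rewrite -map_char_poly cK rmorphM /= map_polyXn map_comp_poly map_polyXn.
have rootK z : z != 0 -> root (char_poly KC) z = root PC (z ^+ M).
  move=> z0; rewrite cKC rootM !rootE hornerXn expf_eq0 (negPf z0) andbF /=.
  by rewrite horner_comp hornerXn.
split; first split.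
- by rewrite [(M * m)%N]mulnC /m [X in (X - _)%N](divn_eq _ M) addKn ltn_pmod.
- by rewrite -rootE root_prod_XsubC; apply/negP => /mu0; rewrite ltxx.
- exact: cK.
- by [].
split; first split.
- by rewrite size_prod_XsubC mum.
- exact: mE.
- exact: rootPC.
split.
  move=> z z0 /mx_pole_resolvent_root; rewrite rootK // => /rootPC zM.
  exists (z / `|z|), `|z|; split; last by rewrite mulrC divfK // normr_eq0.
    by rewrite expr_div_n -normrX gtr0_norm // divff ?gt_eqF.
  exact: normr_ge0.
split; first exact: cC.
split.
  by move=> c cM cm; have [_ ->] := cC c cM; rewrite cm subnn expr0 mul1r.
move=> y; split.
  move=> ry; have y0 : y != 0 by rewrite gt_eqF ?rootPC.
  split => //.
  have yM : (M.-root y) ^+ M = y by rewrite rootCK.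
  exists (M.-root y) => //; rewrite eigenvalue_root_char rootK ?yM //.
  by rewrite rootC_eq0.
case=> y0 [z]; rewrite eigenvalue_root_char => rz yz.
rewrite yz -rootK //; apply: contraNneq y0 => z0.
by rewrite yz z0 expr0n (gtn_eqF M0).
Qed.
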